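(* Let $n\ge0$ be an integer and let $z\in\mathbb{C}$ with $|z|\le1$. Then $${}_3F_2\bigl(1,\tfrac32,\tfrac32+n;2,\tfrac52+n;z\bigr)=\frac{3+2n}{1+2n}\,\frac2z\Biggl(\frac{1+2n}{4^{n}}\frac{1}{z^{n+1/2}}\Biggl[\binom{2n}{n}\arcsin\sqrt z+(-1)^n\sum_{\substack{0\le k\le2n\\k\ne n}}(-1)^k\binom{2n}{k}\frac{\sin[2(n-k)\arcsin\sqrt z]}{2(n-k)}\Biggr]-1\Biggr)$$ and $${}_3F_2\bigl(1,\tfrac32,2+n;2,3+n;z\bigr)=\frac{2(2+n)}{z}\Biggl[\frac{(-1)^{1+n}}{4^{n}}\frac{1}{z^{1+n}}\sum_{k=0}^{1+2n}(-1)^k\binom{1+2n}{k}\frac{\cos[(2n-2k+1)\arcsin\sqrt z]-1}{2n-2k+1}-\frac{1}{1+n}\Biggr].$$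
   Context: The generalized hypergeometric function is ${}_3F_2(a_1,a_2,a_3;b_1,b_2;z)=\sum_{m=0}^{\infty}\frac{(a_1)_m(a_2)_m(a_3)_m}{(b_1)_m(b_2)_m}\frac{z^m}{m!}$, where $(a)_0=1$ and $(a)_m=a(a+1)\dotsm(a+m-1)$ for $m\ge1$; the two series in the claim converge for $|z|\le1$. Square root, $\arcsin$ and non-integer powers are principal branches, so $z^{n+1/2}=(\sqrt z)^{2n+1}$. At $z=0$ the right-hand sides are understood as their limits as $z\to0$ (removable singularities). Empty sums are $0$. *)

(* Defs.v *)
From Stdlib Require Export Reals Factorial.
From Coquelicot Require Export Coquelicot.

Local Open Scope C_scope.

Definition Cexp (z : C) : C :=
  (exp (Re z) * cos (Im z), exp (Re z) * sin (Im z))%R.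

Definition Csin (z : C) : C := (Cexp (Ci * z) - Cexp (- (Ci * z))) / (2 * Ci).

Definition Ccos (z : C) : C := (Cexp (Ci * z) + Cexp (- (Ci * z))) / 2.

(* Principal argument, with values in (-PI, PI]; only meaningful for z <> 0. *)
Definition Carg (z : C) : R :=
  if Rle_dec 0 (Im z) then acos (Re z / Cmod z) else (- acos (Re z / Cmod z))%R.

Definition Clog (z : C) : C := (ln (Cmod z), Carg z).

(* Principal value of z^a; only meaningful for z <> 0. *)
Definition Cpower (z a : C) : C := Cexp (a * Clog z).

(* The case z = 0 is separate because [Cpower 0 _] is not meaningful. *)
Definition Csqrt (z : C) : C := if Ceq_dec z 0 then RtoC 0 else Cpower z (/ 2).

Definition Carcsin (z : C) : C := - Ci * Clog (Ci * z + Csqrt (1 - z ^ 2)).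

Fixpoint pochhammer (a : C) (m : nat) : C :=
  match m with
  | O => 1
  | S p => pochhammer a p * (a + INR p)
  end.

Definition hyp3F2_term (a1 a2 a3 b1 b2 z : C) (m : nat) : C :=
  pochhammer a1 m * pochhammer a2 m * pochhammer a3 m
    / (pochhammer b1 m * pochhammer b2 m) * (z ^ m / INR (fact m)).

(* The series defining 3F2(a1,a2,a3; b1,b2; z) converges and its sum is v. *)
Definition is_hyp3F2 (a1 a2 a3 b1 b2 z v : C) : Prop :=
  is_series (V := C_NormedModule) (hyp3F2_term a1 a2 a3 b1 b2 z) v.

(* Used for k <= m only; [Binomial.C] is Stdlib's real binomial coefficient. *)
Definition binom (m k : nat) : C := RtoC (Binomial.C m k).

(* v is the value at z of the expression f, where f is undefined at 0 and
   its value there is understood as its limit along the punctured plane. *)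
Definition is_value_ext0 (f : C -> C) (z v : C) : Prop :=
  (z <> 0 -> v = f z) /\
  (z = 0 -> filterlim f (locally' (T := C_UniformSpace) (RtoC 0)) (locally v)).

(* Main.v *)
(** With [x = sqrt z] and [c_j = (1/2)_j / j!], both series are, up to elementary factors,
    [sum_j c_j x^(2j+m) / (2j+m)] with [m = 2n+1] or [m = 2n+2], which is the integral of
    [sin^(m-1)] from [0] to [arcsin x]; linearising the power of the sine by the binomial
    theorem gives the closed forms.

    To avoid complex analysis, everything is followed along the segment [t x] with
    [0 <= t <= 1].  The series [A] for [m = 1] satisfies
    [exp (i A) = sqrt (1 - t^2 z) + i t x], so [sin A = t x]; [Re (cos A) >= 0] by the
    intermediate value theorem and [|A| < 3 < PI] by a telescoping bound, and this identifies [A]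
    with the principal value of [arcsin].  Absolute convergence carries the identities to [t = 1],
    including the case [|z| = 1]. *)

From Stdlib Require Import Arith Lra Lia Psatz.
Require Import Defs.

Local Open Scope C_scope.

(** * Complex-valued functions of a real variable *)

(** The endpoint is the obstacle. For [|z| = 1] the series [sum c_j z^j], which governs the
    derivatives at [t = 1], need not converge, and for [z = 1] the derivative is unbounded there. So
    nothing is differentiated at [t = 1]: each identity says that some function has derivative 0 for
    [|t| < 1], and only its continuity is carried to the end.

    All the series share one derivative up to a power of [t]: with [Y(s) = (1 - s z)^(-1/2)], the
    series for [m] differentiates to [t^(m-1) Y(t^2)]. Hence only [Y] needs a differential equation.

    The identities hold for every [x] with [x * x = z], so [x] may be traded for [- x]; the choice
    [x = Csqrt z] enters only in the theorem. Derivatives and continuity are taken componentwise, so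
    the real mean value theorem suffices.

    The hypergeometric coefficients involve [c_(j+1)], not [c_j]: the series is that of the
    primitive without its first term. This is the origin of the division by [z] and of the
    subtracted constant in both closed forms. *)

Definition C_is_derive (f : R -> C) (t : R) (l : C) : Prop :=
  is_derive (fun s => Re (f s)) t (Re l) /\ is_derive (fun s => Im (f s)) t (Im l).

Definition C_continuous (f : R -> C) : Prop :=
  forall t : R, continuous (fun s => Re (f s)) t /\ continuous (fun s => Im (f s)) t.

(** The rules for derivatives produce the operations of abstract algebraic structures; converting
    them to those of [R] lets [ring] recognise them. *)
Ltac real_ring_ops :=
  cbv beta; match goal with |- @eq _ ?a ?b => change (@eq R a b) end;
  repeat match goal with
  | |- context [@scal ?K ?V ?a ?b] => change (@scal K V a b) with (a * b)%R
  | |- context [@mult ?G ?a ?b] => change (@mult G a b) with (a * b)%R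
  | |- context [@plus ?G ?a ?b] => change (@plus G a b) with (a + b)%R
  | |- context [@minus ?G ?a ?b] => change (@minus G a b) with (a - b)%R
  end.

Lemma C_is_derive_const (c : C) (t : R) : C_is_derive (fun _ => c) t 0.
Proof. split; apply (is_derive_const (K := R_AbsRing) (V := R_NormedModule)). Qed.

Lemma C_is_derive_ext (f g : R -> C) (t : R) (l : C) :
  (forall s, f s = g s) -> C_is_derive f t l -> C_is_derive g t l.
Proof.
intros H [H1 H2]; split; [refine (is_derive_ext _ _ _ _ _ H1)|refine (is_derive_ext _ _ _ _ _ H2)];
  intros s; simpl; now rewrite H.
Qed.

Lemma C_is_derive_eq (f : R -> C) (t : R) (l l' : C) :
  C_is_derive f t l -> l = l' -> C_is_derive f t l'.
Proof. intros H <-; exact H. Qed.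

Lemma C_is_derive_plus (f g : R -> C) (t : R) (df dg : C) :
  C_is_derive f t df -> C_is_derive g t dg ->
  C_is_derive (fun s => f s + g s) t (df + dg).
Proof.
intros [H1 H2] [H3 H4].
split; [exact (is_derive_plus _ _ _ _ _ H1 H3)|exact (is_derive_plus _ _ _ _ _ H2 H4)].
Qed.

Lemma C_is_derive_mult (f g : R -> C) (t : R) (df dg : C) :
  C_is_derive f t df -> C_is_derive g t dg ->
  C_is_derive (fun s => f s * g s) t (df * g t + f t * dg).
Proof.
intros [H1 H2] [H3 H4].
assert (M := fun f g df dg Hf Hg =>
  is_derive_mult (K := R_AbsRing) f g t df dg Hf Hg Rmult_comm).
split.
- evar_last.
    exact (is_derive_minus (V := R_NormedModule) _ _ _ _ _
      (M _ _ _ _ H1 H3) (M _ _ _ _ H2 H4)).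
  real_ring_ops; unfold Re, Im; simpl; ring.
- evar_last.
    exact (is_derive_plus (V := R_NormedModule) _ _ _ _ _
      (M _ _ _ _ H1 H4) (M _ _ _ _ H2 H3)).
  real_ring_ops; unfold Re, Im; simpl; ring.
Qed.

Lemma C_is_derive_scal (c : C) (f : R -> C) (t : R) (df : C) :
  C_is_derive f t df -> C_is_derive (fun s => c * f s) t (c * df).
Proof.
intros H; refine (C_is_derive_eq _ _ _ _ (C_is_derive_mult _ _ _ _ _ (C_is_derive_const c t) H) _).
ring.
Qed.

Lemma C_is_derive_RtoC (f : R -> R) (t df : R) :
  is_derive f t df -> C_is_derive (fun s => RtoC (f s)) t (RtoC df).
Proof.
intros H; split; [exact H|].
exact (is_derive_const (K := R_AbsRing) (V := R_NormedModule) 0%R t).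
Qed.

Lemma C_is_derive_Cexp (f : R -> C) (t : R) (df : C) :
  C_is_derive f t df -> C_is_derive (fun s => Cexp (f s)) t (df * Cexp (f t)).
Proof.
intros [H1 H2].
assert (M := fun f g df dg Hf Hg =>
  is_derive_mult (K := R_AbsRing) f g t df dg Hf Hg Rmult_comm).
assert (E := is_derive_comp exp _ _ _ _ (is_derive_exp _) H1).
split.
- evar_last.
    exact (M _ _ _ _ E (is_derive_comp cos _ _ _ _ (is_derive_cos _) H2)).
  real_ring_ops; unfold Cexp, Re, Im; simpl; ring.
- evar_last.
    exact (M _ _ _ _ E (is_derive_comp sin _ _ _ _ (is_derive_sin _) H2)).
  real_ring_ops; unfold Cexp, Re, Im; simpl; ring.
Qed.

Lemma C_is_derive_comp (f : R -> C) (g : R -> R) (t : R) (df : C) (dg : R) :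
  C_is_derive f (g t) df -> is_derive g t dg ->
  C_is_derive (fun s => f (g s)) t (RtoC dg * df).
Proof.
intros [H1 H2] Hg; split.
- replace (Re (RtoC dg * df)) with (scal dg (Re df)).
    exact (is_derive_comp _ _ _ _ _ H1 Hg).
  change (scal dg (Re df)) with (dg * Re df)%R; unfold Re; simpl; ring.
- replace (Im (RtoC dg * df)) with (scal dg (Im df)).
    exact (is_derive_comp _ _ _ _ _ H2 Hg).
  change (scal dg (Im df)) with (dg * Im df)%R; unfold Im; simpl; ring.
Qed.

Lemma C_is_derive_pow (t : R) (m : nat) :
  C_is_derive (fun s => RtoC s ^ S m) t (RtoC (INR (S m)) * RtoC t ^ m).
Proof.
apply (C_is_derive_ext (fun s => RtoC (s ^ S m)%R)).
  intros s; apply RtoC_pow.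
rewrite <- RtoC_pow, <- RtoC_mult.
apply C_is_derive_RtoC; evar_last.
  apply is_derive_pow; apply (is_derive_id (K := R_AbsRing)).
change (one (K := R_AbsRing)) with 1%R; rewrite Rmult_1_r; reflexivity.
Qed.

Lemma C_is_derive_sum (f : nat -> R -> C) (t : R) (df : nat -> C) (n : nat) :
  (forall k, C_is_derive (f k) t (df k)) ->
  C_is_derive (fun s => sum_n (fun k => f k s) n) t (sum_n df n).
Proof.
intros H; induction n as [|n IH].
- apply (C_is_derive_ext (f 0%nat)).
    intros s; now rewrite sum_O.
  rewrite sum_O; apply H.
- apply (C_is_derive_ext (fun s => sum_n (fun k => f k s) n + f (S n) s)).
    intros s; now rewrite sum_Sn.
  rewrite sum_Sn; now apply C_is_derive_plus.
Qed.

Lemma C_continuous_ext (f g : R -> C) :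
  (forall s, f s = g s) -> C_continuous f -> C_continuous g.
Proof.
intros H Hf t; destruct (Hf t) as [H1 H2].
split; [refine (continuous_ext _ _ _ _ H1)|refine (continuous_ext _ _ _ _ H2)];
  intros s; simpl; now rewrite H.
Qed.

Lemma C_continuous_const (c : C) : C_continuous (fun _ => c).
Proof. intros t; split; apply continuous_const. Qed.

Lemma C_continuous_plus (f g : R -> C) :
  C_continuous f -> C_continuous g -> C_continuous (fun s => f s + g s).
Proof.
intros Hf Hg t; destruct (Hf t) as [H1 H2]; destruct (Hg t) as [H3 H4]; split.
- exact (continuous_plus (V := R_NormedModule) _ _ _ H1 H3).
- exact (continuous_plus (V := R_NormedModule) _ _ _ H2 H4).
Qed.

Lemma C_continuous_mult (f g : R -> C) :
  C_continuous f -> C_continuous g -> C_continuous (fun s => f s * g s).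
Proof.
intros Hf Hg t; destruct (Hf t) as [H1 H2]; destruct (Hg t) as [H3 H4]; split.
- exact (continuous_minus (V := R_NormedModule) _ _ _
    (continuous_mult (K := R_AbsRing) _ _ _ H1 H3)
    (continuous_mult (K := R_AbsRing) _ _ _ H2 H4)).
- exact (continuous_plus (V := R_NormedModule) _ _ _
    (continuous_mult (K := R_AbsRing) _ _ _ H1 H4)
    (continuous_mult (K := R_AbsRing) _ _ _ H2 H3)).
Qed.

Lemma C_continuous_RtoC (f : R -> R) :
  (forall t, continuous f t) -> C_continuous (fun s => RtoC (f s)).
Proof. intros H t; split; [apply H|apply continuous_const]. Qed.

Lemma C_continuous_Cexp (f : R -> C) :
  C_continuous f -> C_continuous (fun s => Cexp (f s)).
Proof.
intros Hf t; destruct (Hf t) as [H1 H2]; split; simpl.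
- apply (continuous_mult (K := R_AbsRing)).
    now apply continuous_comp; [|apply continuous_exp].
  now apply continuous_comp; [|apply continuous_cos].
- apply (continuous_mult (K := R_AbsRing)).
    now apply continuous_comp; [|apply continuous_exp].
  now apply continuous_comp; [|apply continuous_sin].
Qed.

Lemma C_continuous_sum (f : nat -> R -> C) (n : nat) :
  (forall k, C_continuous (f k)) ->
  C_continuous (fun s => sum_n (fun k => f k s) n).
Proof.
intros H; induction n as [|n IH].
- apply (C_continuous_ext (f 0%nat)); [|apply H].
  intros s; now rewrite sum_O.
- apply (C_continuous_ext (fun s => sum_n (fun k => f k s) n + f (S n) s)).
    intros s; now rewrite sum_Sn.
  now apply C_continuous_plus.
Qed.

Lemma C_eq (a b : C) : Re a = Re b -> Im a = Im b -> a = b.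
Proof. destruct a, b; simpl; intros -> ->; reflexivity. Qed.

Lemma is_derive_0_const (f : R -> R) (t : R) :
  (forall s, (Rabs s < 1)%R -> is_derive f s 0%R) -> (Rabs t < 1)%R -> f t = f 0%R.
Proof.
intros H Ht.
assert (K : forall s, (Rmin 0 t <= s <= Rmax 0 t -> Rabs s < 1)%R).
  intros s; apply Rabs_def2 in Ht; unfold Rmin, Rmax.
  destruct (Rle_dec 0 t); intros; apply Rabs_def1; lra.
destruct (MVT_gen f 0 t (fun _ => 0%R)) as [c [_ Hc]].
- intros s Hs; apply H, K; lra.
- intros s Hs; apply continuity_pt_filterlim.
  apply (ex_derive_continuous f); exists 0%R; apply H, K, Hs.
- lra.
Qed.

Lemma sin_lt_1 (t : R) : (0 <= t < PI / 2)%R -> (0 <= sin t < 1)%R.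
Proof.
intros H; assert (HP := PI_RGT_0); split.
- apply sin_ge_0; lra.
- rewrite <- sin_PI2; apply sin_increasing_1; lra.
Qed.

(* Composing with [sin] turns one-sided continuity at the endpoint 1 into continuity on R. *)
Lemma is_derive_0_const_1 (f : R -> R) :
  (forall s, (Rabs s < 1)%R -> is_derive f s 0%R) ->
  (forall s, continuous (fun u => f (sin u)) s) -> f 1%R = f 0%R.
Proof.
intros H Hc; assert (HP := PI_RGT_0).
destruct (MVT_gen (fun u => f (sin u)) 0 (PI / 2) (fun _ => 0%R)) as [c [_ E]].
- intros s Hs; rewrite Rmin_left, Rmax_right in Hs by lra.
  evar_last.
    apply is_derive_comp; [apply H|apply is_derive_sin].
    destruct (sin_lt_1 s); [lra|]; apply Rabs_def1; lra.
  real_ring_ops; ring.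
- intros s Hs; apply continuity_pt_filterlim; apply Hc.
- rewrite sin_PI2, sin_0 in E; lra.
Qed.

Lemma C_is_derive_0_const (f : R -> C) (t : R) :
  (forall s, (Rabs s < 1)%R -> C_is_derive f s 0) -> (Rabs t < 1)%R -> f t = f 0%R.
Proof.
intros H Ht; apply C_eq;
  [apply (is_derive_0_const (fun s => Re (f s)))|apply (is_derive_0_const (fun s => Im (f s)))];
  trivial; intros s Hs; apply (H s Hs).
Qed.

Lemma C_is_derive_0_const_1 (f : R -> C) :
  (forall s, (Rabs s < 1)%R -> C_is_derive f s 0) ->
  C_continuous (fun u => f (sin u)) -> f 1%R = f 0%R.
Proof.
intros H Hc; apply C_eq;
  [apply (is_derive_0_const_1 (fun s => Re (f s)))|apply (is_derive_0_const_1 (fun s => Im (f s)))];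
  try (intros s Hs; apply (H s Hs)); intros s; apply (Hc s).
Qed.

(** * Complex elementary functions *)

Lemma Cexp_0 : Cexp 0 = 1.
Proof. unfold Cexp; simpl; rewrite exp_0, cos_0, sin_0; apply C_eq; simpl; ring. Qed.

Lemma Cexp_plus (a b : C) : Cexp (a + b) = Cexp a * Cexp b.
Proof.
unfold Cexp; apply C_eq; simpl; rewrite exp_plus, ?cos_plus, ?sin_plus; unfold Re, Im; ring.
Qed.

Lemma Cexp_mult_opp (a : C) : Cexp a * Cexp (- a) = 1.
Proof. rewrite <- Cexp_plus, <- Cexp_0; f_equal; ring. Qed.

Lemma Cexp_pow (a : C) (n : nat) : Cexp a ^ n = Cexp (RtoC (INR n) * a).
Proof.
induction n as [|n IH].
- simpl; rewrite <- Cexp_0; f_equal; ring.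
- rewrite Cpow_S, IH, <- Cexp_plus, S_INR, RtoC_plus; f_equal; ring.
Qed.

Lemma Cmod_Cexp (w : C) : Cmod (Cexp w) = exp (Re w).
Proof.
unfold Cmod, Cexp; simpl.
replace (_ + _)%R with (exp (Re w) ^ 2)%R.
  apply sqrt_pow2; left; apply exp_pos.
assert (H := sin2_cos2 (Im w)); unfold Rsqr in H; nra.
Qed.

Lemma Clog_Cexp (w : C) : (- PI < Im w <= PI)%R -> Clog (Cexp w) = w.
Proof.
intros H; unfold Clog; rewrite Cmod_Cexp, ln_exp; apply C_eq; simpl; trivial.
unfold Carg; rewrite Cmod_Cexp.
replace (Re (Cexp w) / exp (Re w))%R with (cos (Im w)).
2: { simpl; field; assert (K := exp_pos (Re w)); lra. }
assert (E := exp_pos (Re w)); simpl.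
(* The exponential is positive, so the test in [Carg] is the sign of [sin (Im w)], which on
   [(-PI, PI]] separates [Im w >= 0] from [Im w < 0]. *)
destruct (Rle_dec 0 (exp (Re w) * sin (Im w))) as [D|D].
- apply acos_cos; split; [|lra].
  destruct (Rle_or_lt 0 (Im w)) as [|L]; trivial.
  assert (sin (Im w) < 0)%R by (apply sin_lt_0_var; lra); nra.
- rewrite <- cos_neg, acos_cos; [ring|].
  destruct (Rle_or_lt (Im w) 0) as [|L]; [lra|].
  exfalso; apply D; assert (0 <= sin (Im w))%R by (apply sin_ge_0; lra); nra.
Qed.

Lemma Re_div_Cmod_bound (w : C) : w <> 0 -> (-1 <= Re w / Cmod w <= 1)%R.
Proof.
intros H; apply Cmod_gt_0 in H.
assert (K := re_le_Cmod w); apply Rabs_le_between in K.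
split; [apply Rle_div_r|apply Rle_div_l]; lra.
Qed.

(** [acos] recovers the argument up to sign, its sine being [|Im w| / |w|]; the case distinction in
    [Carg] restores the sign of [Im w]. *)
Lemma Cexp_Clog (w : C) : w <> 0 -> Cexp (Clog w) = w.
Proof.
intros H; assert (B := Re_div_Cmod_bound w H).
assert (P := proj1 (Cmod_gt_0 w) H).
assert (S : sin (acos (Re w / Cmod w)) = (Rabs (Im w) / Cmod w)%R).
  rewrite sin_acos by exact B.
  apply sqrt_lem_1.
  - unfold Rsqr; nra.
  - apply Rle_div_r; [exact P|]; rewrite Rmult_0_l; apply Rabs_pos.
  - assert (M : (Cmod w * Cmod w = Re w * Re w + Im w * Im w)%R).
      unfold Cmod; rewrite sqrt_sqrt; [unfold Re, Im; ring|nra].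
    assert (A : (Rabs (Im w) * Rabs (Im w) = Im w * Im w)%R).
      rewrite <- Rabs_mult; apply Rabs_pos_eq; nra.
    unfold Rsqr; field_simplify; [|lra|lra].
    f_equal; simpl; lra.
unfold Cexp, Clog, Carg; apply C_eq; simpl; rewrite exp_ln by exact P;
  destruct (Rle_dec 0 (Im w)) as [D|D]; rewrite ?cos_neg, ?sin_neg, ?cos_acos, ?S by exact B.
- field; lra.
- field; lra.
- rewrite Rabs_pos_eq by exact D; field; lra.
- rewrite Rabs_left by lra; field; lra.
Qed.

Lemma Im_Clog_half_plane (w : C) : (0 < Re w)%R -> (- (PI / 2) < Im (Clog w) < PI / 2)%R.
Proof.
intros H.
assert (N : w <> 0) by (intros ->; simpl in H; lra).
assert (P := proj1 (Cmod_gt_0 w) N).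
assert (B := Re_div_Cmod_bound w N).
assert (K : (0 <= acos (Re w / Cmod w) < PI / 2)%R).
  destruct (acos_bound (Re w / Cmod w)) as [A1 A2]; split; [exact A1|].
  apply Rnot_le_lt; intros L.
  assert (C := cos_le_0 (acos (Re w / Cmod w)) L ltac:(assert (PP := PI_RGT_0); lra)).
  rewrite cos_acos in C by exact B.
  assert (0 < Re w / Cmod w)%R by (apply Rdiv_lt_0_compat; lra); lra.
assert (PP := PI_RGT_0); simpl; unfold Carg; destruct (Rle_dec 0 (Im w)); lra.
Qed.

Lemma Csqrt_sqr (z : C) : Csqrt z * Csqrt z = z.
Proof.
unfold Csqrt; destruct (Ceq_dec z 0) as [->|H]; [ring|].
unfold Cpower; rewrite <- Cexp_plus.
replace (/ 2 * Clog z + / 2 * Clog z) with (Clog z) by field.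
now apply Cexp_Clog.
Qed.

(** An argument strictly between [-PI/2] and [PI/2] can be doubled without leaving the principal
    range, so [Clog (w * w) = 2 * Clog w]. *)
Lemma Csqrt_unique (w : C) : (0 < Re w)%R -> Csqrt (w * w) = w.
Proof.
intros H.
assert (N : w <> 0) by (intros ->; simpl in H; lra).
assert (E : Clog (w * w) = 2 * Clog w).
  rewrite <- (Cexp_Clog w N) at 1 2; rewrite <- Cexp_plus.
  assert (B := Im_Clog_half_plane w H).
  rewrite Clog_Cexp; [ring|].
  change (Im (Clog w + Clog w)) with (Im (Clog w) + Im (Clog w))%R; lra.
unfold Csqrt; destruct (Ceq_dec (w * w) 0) as [D|D].
  exfalso; exact (Cmult_neq_0 _ _ N N D).
unfold Cpower; rewrite E.
replace (/ 2 * (2 * Clog w)) with (Clog w) by field.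
now apply Cexp_Clog.
Qed.

Lemma Csqrt_0 : Csqrt 0 = 0.
Proof. unfold Csqrt; destruct (Ceq_dec 0 0); tauto. Qed.

Lemma Cpower_add_half (z : C) (n : nat) :
  z <> 0 -> Cpower z (INR n + 1 / 2) = Csqrt z ^ (2 * n + 1).
Proof.
intros H; unfold Csqrt; destruct (Ceq_dec z 0) as [|_]; [contradiction|].
unfold Cpower; rewrite Cexp_pow, plus_INR, mult_INR, RtoC_plus, RtoC_mult.
apply (f_equal Cexp); simpl INR; rewrite RtoC_plus; field.
Qed.

Lemma Ci_sqr : Ci * Ci = -1.
Proof. apply C_eq; simpl; ring. Qed.

Lemma Ccos_add_Ci_Csin (w : C) : Ccos w + Ci * Csin w = Cexp (Ci * w).
Proof.
unfold Ccos, Csin; field; apply Ci_nz.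
Qed.

Lemma Csin_sqr_add_Ccos_sqr (w : C) : Csin w * Csin w + Ccos w * Ccos w = 1.
Proof.
transitivity ((Ccos w + Ci * Csin w) * (Ccos w - Ci * Csin w)).
- replace ((Ccos w + Ci * Csin w) * (Ccos w - Ci * Csin w))
    with (Ccos w * Ccos w - (Ci * Ci) * (Csin w * Csin w)) by ring.
  rewrite Ci_sqr; ring.
- rewrite Ccos_add_Ci_Csin.
  replace (Ccos w - Ci * Csin w) with (Cexp (- (Ci * w))); [apply Cexp_mult_opp|].
  unfold Ccos, Csin; field; apply Ci_nz.
Qed.

(** The two hypotheses are the two branch conditions, one for the logarithm and one for the square
    root; granted these, [cos w + i sin w = exp (i w)] does the rest. *)
Lemma Carcsin_Csin (w : C) :
  (- PI < Re w <= PI)%R -> Csqrt (1 - Csin w ^ 2) = Ccos w -> Carcsin (Csin w) = w.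
Proof.
intros H E; unfold Carcsin; rewrite E.
replace (Ci * Csin w + Ccos w) with (Ccos w + Ci * Csin w) by ring.
rewrite Ccos_add_Ci_Csin, Clog_Cexp.
- transitivity (- (Ci * Ci) * w); [ring|]; rewrite Ci_sqr; ring.
- replace (Im (Ci * w)) with (Re w); [exact H|].
  unfold Re, Im; simpl; ring.
Qed.

(** * Finite sums and the binomial theorem *)

Lemma Csum_O (f : nat -> C) : sum_n f 0 = f 0%nat.
Proof. exact (sum_O f). Qed.

Lemma Csum_Sn (f : nat -> C) (n : nat) : sum_n f (S n) = sum_n f n + f (S n).
Proof. exact (sum_Sn f n). Qed.

Lemma Csum_ext (f g : nat -> C) (n : nat) :
  (forall k, (k <= n)%nat -> f k = g k) -> sum_n f n = sum_n g n.
Proof. exact (sum_n_ext_loc f g n). Qed.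

Lemma Csum_plus (f g : nat -> C) (n : nat) :
  sum_n (fun k => f k + g k) n = sum_n f n + sum_n g n.
Proof. exact (sum_n_plus (G := C_AbelianMonoid) f g n). Qed.

Lemma Csum_scal (c : C) (f : nat -> C) (n : nat) :
  sum_n (fun k => c * f k) n = c * sum_n f n.
Proof. exact (sum_n_mult_l (K := C_Ring) c f n). Qed.

Lemma Csum_shift (f : nat -> C) (n : nat) :
  sum_n f (S n) = f 0%nat + sum_n (fun k => f (S k)) n.
Proof.
induction n as [|n IH].
- rewrite Csum_Sn, !Csum_O; reflexivity.
- rewrite Csum_Sn, IH, (Csum_Sn (fun k => f (S k))).
  symmetry; apply Cplus_assoc.
Qed.

Lemma Csum_remove (f : nat -> C) (j n : nat) :
  (j <= n)%nat ->
  sum_n f n = f j + sum_n (fun k => if Nat.eq_dec k j then RtoC 0 else f k) n :> C.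
Proof.
intros H.
(* Stated for all [n], including [n < j], so that the induction can pass through the index [j]. *)
assert (G : sum_n f n = (if le_dec j n then f j else 0) +
    sum_n (fun k => if Nat.eq_dec k j then RtoC 0 else f k) n :> C).
  clear H; induction n as [|n IH].
  - rewrite !Csum_O; destruct (le_dec j 0), (Nat.eq_dec 0 j); try lia; subst; ring.
  - rewrite !Csum_Sn, IH.
    destruct (le_dec j n), (le_dec j (S n)), (Nat.eq_dec (S n) j); try lia; subst; ring.
rewrite G; destruct (le_dec j n); [reflexivity|contradiction].
Qed.

Lemma binom_pascal (n k : nat) :
  (k < n)%nat -> binom n k + binom n (S k) = binom (S n) (S k).
Proof. intros H; unfold binom; rewrite <- RtoC_plus; f_equal; now apply pascal. Qed.

Lemma binom_0 (n : nat) : binom n 0 = 1.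
Proof.
unfold binom, Binomial.C; f_equal; rewrite Nat.sub_0_r; simpl; field; apply INR_fact_neq_0.
Qed.

Lemma binom_diag (n : nat) : binom n n = 1.
Proof.
unfold binom, Binomial.C; f_equal; rewrite Nat.sub_diag; simpl; field; apply INR_fact_neq_0.
Qed.

(** One copy of the sum loses its first term and the other its last; Pascal's rule joins what
    remains. The exponent 1 is a base case because the new sum must have both end terms split off
    and still leave an interior. *)
Lemma Cbinomial (a b : C) (n : nat) :
  (a + b) ^ n = sum_n (fun k => binom n k * (a ^ (n - k) * b ^ k)) n.
Proof.
induction n as [|[|n] IH].
- rewrite Csum_O, binom_0; simpl; ring.
- rewrite Csum_Sn, Csum_O, binom_0, binom_diag; simpl; ring.
- rewrite Cpow_S, IH.
  set (f := fun k => binom (S n) k * (a ^ (S n - k) * b ^ k)).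
  transitivity (a * sum_n f (S n) + b * sum_n f (S n)); [ring|].
  rewrite (Csum_shift f) at 1; rewrite (Csum_Sn f), Csum_shift, Csum_Sn; unfold f.
  rewrite (Csum_ext (fun k => binom (S (S n)) (S k) * _)
    (fun k => a * (binom (S n) (S k) * (a ^ (S n - S k) * b ^ S k)) +
              b * (binom (S n) k * (a ^ (S n - k) * b ^ k)))).
    rewrite Csum_plus, !Csum_scal, !binom_0, !binom_diag, !Nat.sub_diag, !Nat.sub_0_r.
    rewrite !Cpow_S; simpl (_ ^ 0); ring.
  intros k Hk; rewrite <- binom_pascal by lia.
  replace (S (S n) - S k)%nat with (S (n - k)) by lia.
  replace (S n - k)%nat with (S (n - k)) by lia.
  replace (S n - S k)%nat with (n - k)%nat by lia.
  rewrite !Cpow_S; ring.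
Qed.

(** * Linearisation of powers of the sine *)

Lemma Csin_pow_exp (w : C) (n : nat) :
  (2 * Ci) ^ n * Csin w ^ n =
  sum_n (fun k => (-1) ^ k * binom n k * Cexp (Ci * ((RtoC (INR n) - 2 * INR k) * w))) n.
Proof.
rewrite <- Cpow_mult_l.
replace (2 * Ci * Csin w) with (Cexp (Ci * w) + -1 * Cexp (- (Ci * w))).
2: { unfold Csin; field; apply Ci_nz. }
rewrite Cbinomial; apply Csum_ext; intros k Hk.
rewrite Cpow_mult_l, !Cexp_pow.
replace (Ci * ((RtoC (INR n) - 2 * INR k) * w))
  with (INR (n - k) * (Ci * w) + INR k * - (Ci * w)).
- rewrite Cexp_plus; ring.
- rewrite minus_INR, RtoC_minus by exact Hk; ring.
Qed.

Lemma Csin_opp (w : C) : Csin (- w) = - Csin w.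
Proof.
unfold Csin.
replace (Ci * - w) with (- (Ci * w)) by ring.
replace (- - (Ci * w)) with (Ci * w) by ring.
field; apply Ci_nz.
Qed.

Lemma Ci_pow_even (n : nat) : (2 * Ci) ^ (2 * n) = (-1) ^ n * 4 ^ n.
Proof.
rewrite Cpow_mult_r, <- Cpow_mult_l; f_equal.
simpl; transitivity (4 * (Ci * Ci)); [ring|]; rewrite Ci_sqr; ring.
Qed.

Lemma Copp1_pow_sqr (n : nat) : (-1) ^ n * (-1) ^ n = 1.
Proof.
rewrite <- Cpow_mult_l; replace (-1 * -1) with (RtoC 1) by ring; apply Cpow_1_l.
Qed.

(** An even power of the sine is unchanged under [w -> - w], so averaging the exponential expansions
    at [w] and [- w] turns each exponential into a cosine; no reindexing [k -> 2n - k] is needed. *)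
Lemma Csin_pow_even (w : C) (n : nat) :
  4 ^ n * Csin w ^ (2 * n) = (-1) ^ n *
  sum_n (fun k => (-1) ^ k * binom (2 * n) k * Ccos (2 * (INR n - INR k) * w)) (2 * n).
Proof.
assert (H1 := Csin_pow_exp w (2 * n)).
assert (H2 := Csin_pow_exp (- w) (2 * n)).
rewrite Csin_opp in H2.
replace (- Csin w) with (-1 * Csin w) in H2 by ring.
rewrite (Cpow_mult_l (-1)), (Cpow_mult_r (-1)) in H2.
replace ((-1) ^ 2) with (RtoC 1) in H2 by (simpl; ring).
rewrite Cpow_1_l, Cmult_1_l in H2.
rewrite (Csum_ext _ (fun k => / 2 *
  ((-1) ^ k * binom (2 * n) k * Cexp (Ci * ((RtoC (INR (2 * n)) - 2 * INR k) * w)) +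
   (-1) ^ k * binom (2 * n) k * Cexp (Ci * ((RtoC (INR (2 * n)) - 2 * INR k) * - w))))).
- rewrite Csum_scal, Csum_plus, <- H1, <- H2, Ci_pow_even.
  transitivity ((-1) ^ n * (-1) ^ n * (4 ^ n * Csin w ^ (2 * n))).
    rewrite Copp1_pow_sqr; ring.
  field.
- intros k _; unfold Ccos; rewrite mult_INR, RtoC_mult; simpl (INR 2).
  replace (Ci * ((RtoC (1 + 1) * INR n - 2 * INR k) * w))
    with (Ci * (2 * (INR n - INR k) * w)) by (rewrite RtoC_plus; ring).
  replace (Ci * ((RtoC (1 + 1) * INR n - 2 * INR k) * - w))
    with (- (Ci * (2 * (INR n - INR k) * w))) by (rewrite RtoC_plus; ring).
  field.
Qed.

(** As in the even case, but an odd power changes sign with [w], so the two expansions are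
    subtracted and sines appear. *)
Lemma Csin_pow_odd (w : C) (n : nat) :
  4 ^ n * Csin w ^ (1 + 2 * n) = (-1) ^ n * / 2 *
  sum_n (fun k => (-1) ^ k * binom (1 + 2 * n) k *
    Csin ((2 * INR n - 2 * INR k + 1) * w)) (1 + 2 * n).
Proof.
assert (H1 := Csin_pow_exp w (1 + 2 * n)).
assert (H2 := Csin_pow_exp (- w) (1 + 2 * n)).
rewrite Csin_opp in H2.
replace (- Csin w) with (-1 * Csin w) in H2 by ring.
rewrite (Cpow_mult_l (-1)), (Cpow_add_r (-1)), (Cpow_mult_r (-1)) in H2.
replace ((-1) ^ 2) with (RtoC 1) in H2 by (simpl; ring).
rewrite Cpow_1_l, Cpow_1_r in H2.
rewrite (Csum_ext _ (fun k => / (2 * Ci) *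
  ((-1) ^ k * binom (1 + 2 * n) k * Cexp (Ci * ((RtoC (INR (1 + 2 * n)) - 2 * INR k) * w)) +
   -1 * ((-1) ^ k * binom (1 + 2 * n) k * Cexp (Ci * ((RtoC (INR (1 + 2 * n)) - 2 * INR k) * - w)))))).
- rewrite Csum_scal, Csum_plus, Csum_scal, <- H1, <- H2, (Cpow_add_r (2 * Ci)), Ci_pow_even, Cpow_1_r.
  transitivity ((-1) ^ n * (-1) ^ n * (4 ^ n * Csin w ^ (1 + 2 * n))).
    rewrite Copp1_pow_sqr; ring.
  field; apply Ci_nz.
- intros k _; unfold Csin; rewrite plus_INR, mult_INR, RtoC_plus, RtoC_mult; simpl INR.
  replace (Ci * ((1 + RtoC (1 + 1) * INR n - 2 * INR k) * w))
    with (Ci * ((2 * INR n - 2 * INR k + 1) * w)) by (rewrite RtoC_plus; ring).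
  replace (Ci * ((1 + RtoC (1 + 1) * INR n - 2 * INR k) * - w))
    with (- (Ci * ((2 * INR n - 2 * INR k + 1) * w))) by (rewrite RtoC_plus; ring).
  field; apply Ci_nz.
Qed.

(** * Power series *)

(* [(1/2)_j / j!], the coefficient of [s^j] in [(1 - s)^(-1/2)]. *)
Fixpoint half_coef (j : nat) : R :=
  match j with
  | O => 1
  | S p => half_coef p * ((2 * INR p + 1) / (2 * INR p + 2))
  end.

Lemma half_coef_pos (j : nat) : (0 < half_coef j)%R.
Proof.
induction j as [|j IH]; simpl; [lra|].
assert (H := pos_INR j); apply Rmult_lt_0_compat; [exact IH|].
apply Rdiv_lt_0_compat; lra.
Qed.

(** Consecutive coefficients have ratio [1 - 1/(2j+2)]. Summability follows with an explicit bound
    and without the asymptotics of the central binomial coefficients. *)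
Lemma half_coef_telescope (j : nat) :
  (half_coef j / (2 * INR j + 2) = half_coef j - half_coef (S j))%R.
Proof. assert (H := pos_INR j); simpl; field; lra. Qed.

Lemma half_coef_le_1 (j : nat) : (half_coef j <= 1)%R.
Proof.
induction j as [|j IH]; [simpl; lra|].
assert (H := pos_INR j); assert (K := half_coef_pos j).
assert (T := half_coef_telescope j).
assert (0 < half_coef j / (2 * INR j + 2))%R by (apply Rdiv_lt_0_compat; lra).
lra.
Qed.

Lemma sum_half_coef (n : nat) :
  sum_n (fun j => half_coef j / (2 * INR j + 2))%R n = (1 - half_coef (S n))%R :> R.
Proof.
induction n as [|n IH].
- rewrite sum_O, half_coef_telescope; reflexivity.
- rewrite sum_Sn, IH, half_coef_telescope; real_ring_ops; ring.
Qed.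

Lemma ex_series_half_coef : ex_series (fun j => half_coef j / (2 * INR j + 2))%R.
Proof.
apply ex_finite_lim_seq_incr with (M := 1%R); intros n; rewrite !sum_half_coef.
- assert (H := pos_INR (S n)); assert (K := half_coef_pos (S n)).
  assert (T := half_coef_telescope (S n)).
  assert (0 < half_coef (S n) / (2 * INR (S n) + 2))%R by (apply Rdiv_lt_0_compat; lra).
  lra.
- assert (K := half_coef_pos (S n)); lra.
Qed.

Lemma Series_half_coef : (Series (fun j => half_coef j / (2 * INR j + 2)) <= 1)%R.
Proof.
assert (H := Series_correct _ ex_series_half_coef).
refine (is_lim_seq_le (sum_n (fun j => half_coef j / (2 * INR j + 2))%R) (fun _ => 1%R)
  (Finite _) (Finite 1) _ H (is_lim_seq_const 1)).
intros n; rewrite sum_half_coef; assert (K := half_coef_pos (S n)); lra.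
Qed.

(** The powers of [z] are put into the coefficients, so that the variable of the power series is the
    real number [t ^ 2] and the real theory applies to each component. *)
Definition arcsin_coef (m : nat) (z : C) (j : nat) : C :=
  RtoC (half_coef j / (2 * INR j + INR m)) * z ^ j.

Lemma Cmod_pow_le_1 (z : C) (j : nat) : (Cmod z <= 1)%R -> (Cmod (z ^ j) <= 1)%R.
Proof.
intros H; rewrite Cmod_pow; rewrite <- (pow1 j); apply pow_incr; split; [apply Cmod_ge_0|exact H].
Qed.

(** Since [2j + 2 <= 2 (2j + m)] for [m >= 1], a single telescoping majorant serves every [m]. *)
Lemma Cmod_arcsin_coef (m : nat) (z : C) (j : nat) :
  (1 <= m)%nat -> (Cmod z <= 1)%R ->
  (Cmod (arcsin_coef m z j) <= 2 * (half_coef j / (2 * INR j + 2)))%R.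
Proof.
intros Hm Hz; unfold arcsin_coef; rewrite Cmod_mult, Cmod_R.
assert (P := pos_INR j); assert (K := half_coef_pos j).
assert (M : (1 <= INR m)%R) by (apply (le_INR 1); exact Hm).
rewrite Rabs_pos_eq by (left; apply Rdiv_lt_0_compat; lra).
apply Rle_trans with (half_coef j / (2 * INR j + INR m) * 1)%R.
- apply Rmult_le_compat_l; [left; apply Rdiv_lt_0_compat; lra|now apply Cmod_pow_le_1].
- rewrite Rmult_1_r; unfold Rdiv.
  replace (2 * (half_coef j * / (2 * INR j + 2)))%R
    with (half_coef j * (2 * / (2 * INR j + 2)))%R by ring.
  apply Rmult_le_compat_l; [lra|].
  apply Rmult_le_reg_r with ((2 * INR j + INR m) * (2 * INR j + 2))%R; [nra|].
  field_simplify; lra.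
Qed.

(** * Power series with complex coefficients in a real variable *)

Lemma Re_RtoC_mult (r : R) (c : C) : Re (RtoC r * c) = (r * Re c)%R.
Proof. unfold Re; simpl; ring. Qed.

Lemma Im_RtoC_mult (r : R) (c : C) : Im (RtoC r * c) = (r * Im c)%R.
Proof. unfold Im; simpl; ring. Qed.

Lemma Rabs_Im_le_Cmod (c : C) : (Rabs (Im c) <= Cmod c)%R.
Proof. apply Rle_trans with (2 := Rmax_Cmod c); apply Rmax_r. Qed.

Definition C_pseries (a : nat -> C) (s : R) : C :=
  (PSeries (fun n => Re (a n)) s, PSeries (fun n => Im (a n)) s).

Definition C_ex_pseries (a : nat -> C) (s : R) : Prop :=
  ex_series (fun n => Re (a n) * s ^ n)%R /\ ex_series (fun n => Im (a n) * s ^ n)%R.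

Lemma C_pseries_ext (a b : nat -> C) (s : R) :
  (forall n, a n = b n) -> C_pseries a s = C_pseries b s.
Proof.
intros H; unfold C_pseries; f_equal; apply PSeries_ext; intros n; now rewrite H.
Qed.

Lemma C_pseries_0 (a : nat -> C) : C_pseries a 0 = a 0%nat.
Proof. unfold C_pseries; rewrite !PSeries_0; now destruct (a 0%nat). Qed.

Lemma C_pseries_linear (p q : C) (a b : nat -> C) (s : R) :
  C_ex_pseries a s -> C_ex_pseries b s ->
  C_pseries (fun n => p * a n + q * b n) s = p * C_pseries a s + q * C_pseries b s.
Proof.
intros [A1 A2] [B1 B2].
apply Series_correct in A1, A2, B1, B2.
apply C_eq; simpl; apply is_series_unique.
- evar_last.
    eapply is_series_ext; [|
      exact (is_series_plus _ _ _ _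
        (is_series_plus _ _ _ _ (is_series_scal_r (Re p) _ _ A1) (is_series_scal_r (- Im p) _ _ A2))
        (is_series_plus _ _ _ _ (is_series_scal_r (Re q) _ _ B1) (is_series_scal_r (- Im q) _ _ B2)))].
    intros n; real_ring_ops; unfold Re, Im; simpl; ring.
  real_ring_ops; unfold PSeries, Re, Im; simpl; ring.
- evar_last.
    eapply is_series_ext; [|
      exact (is_series_plus _ _ _ _
        (is_series_plus _ _ _ _ (is_series_scal_r (Im p) _ _ A1) (is_series_scal_r (Re p) _ _ A2))
        (is_series_plus _ _ _ _ (is_series_scal_r (Im q) _ _ B1) (is_series_scal_r (Re q) _ _ B2)))].
    intros n; real_ring_ops; unfold Re, Im; simpl; ring.
  real_ring_ops; unfold PSeries, Re, Im; simpl; ring.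
Qed.

Lemma CV_radius_ge_1 (a : nat -> R) (s : R) :
  (forall n, (Rabs (a n) <= 1)%R) -> (Rabs s < 1)%R -> Rbar_lt (Rabs s) (CV_radius a).
Proof.
intros H Hs; apply Rbar_lt_le_trans with (y := Finite 1); [exact Hs|].
apply (proj1 (CV_radius_bounded a)); exists 1%R; intros n; now rewrite pow1, Rmult_1_r.
Qed.

Definition C_deriv_coef (a : nat -> C) (n : nat) : C := RtoC (INR (S n)) * a (S n).

Lemma C_pseries_is_derive (a : nat -> C) (s : R) :
  (forall n, (Cmod (a n) <= 1)%R) -> (Rabs s < 1)%R ->
  C_is_derive (C_pseries a) s (C_pseries (C_deriv_coef a) s).
Proof.
intros H Hs; split; simpl.
- rewrite (PSeries_ext _ (PS_derive (fun n => Re (a n)))).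
    apply is_derive_PSeries, CV_radius_ge_1; [intros n|exact Hs].
    apply Rle_trans with (2 := H n); apply re_le_Cmod.
  intros n; apply Re_RtoC_mult.
- rewrite (PSeries_ext _ (PS_derive (fun n => Im (a n)))).
    apply is_derive_PSeries, CV_radius_ge_1; [intros n|exact Hs].
    apply Rle_trans with (2 := H n); apply Rabs_Im_le_Cmod.
  intros n; apply Im_RtoC_mult.
Qed.

Lemma C_ex_pseries_bounded (a : nat -> C) (s : R) :
  (forall n, (Cmod (a n) <= 1)%R) -> (Rabs s < 1)%R -> C_ex_pseries a s.
Proof.
intros H Hs; split; apply ex_series_Rabs, CV_disk_inside, CV_radius_ge_1; trivial;
  intros n; apply Rle_trans with (2 := H n); [apply re_le_Cmod|apply Rabs_Im_le_Cmod].
Qed.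

(** The operator [s d/ds] keeps the index in place, so series identities involving derivatives can
    be compared coefficient by coefficient. *)
Lemma mult_C_pseries_deriv (a : nat -> C) (s : R) :
  RtoC s * C_pseries (C_deriv_coef a) s = C_pseries (fun n => RtoC (INR n) * a n) s.
Proof.
apply C_eq.
- transitivity (s * PSeries (fun n => Re (C_deriv_coef a n)) s)%R; [apply Re_RtoC_mult|].
  rewrite <- PSeries_incr_1; apply PSeries_ext; intros [|n].
  + rewrite Re_RtoC_mult; simpl; symmetry; apply Rmult_0_l.
  + reflexivity.
- transitivity (s * PSeries (fun n => Im (C_deriv_coef a n)) s)%R; [apply Im_RtoC_mult|].
  rewrite <- PSeries_incr_1; apply PSeries_ext; intros [|n].
  + rewrite Im_RtoC_mult; simpl; symmetry; apply Rmult_0_l.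
  + reflexivity.
Qed.

Lemma C_ex_pseries_deriv (a : nat -> C) (s : R) :
  (forall n, (Cmod (a n) <= 1)%R) -> (Rabs s < 1)%R ->
  C_ex_pseries (fun n => RtoC (INR n) * a n) s.
Proof.
assert (G : forall b : nat -> R, (forall n, (Rabs (b n) <= 1)%R) -> (Rabs s < 1)%R ->
    ex_series (fun n => INR n * b n * s ^ n)%R).
  intros b Hb Hs.
  apply ex_series_incr_1.
  apply ex_series_ext with (fun n => s * (PS_derive b n * s ^ n))%R.
    intros n; unfold PS_derive; simpl (s ^ S n)%R; simpl; ring.
  apply (ex_series_scal_l (K := R_AbsRing) s (fun n => PS_derive b n * s ^ n)%R).
  apply ex_series_Rabs, CV_disk_inside; rewrite CV_radius_derive.
  now apply CV_radius_ge_1.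
intros H Hs; split.
- apply (ex_series_ext (fun n => INR n * Re (a n) * s ^ n)%R).
    intros n; now rewrite Re_RtoC_mult.
  apply G; trivial; intros n; apply Rle_trans with (2 := H n); apply re_le_Cmod.
- apply (ex_series_ext (fun n => INR n * Im (a n) * s ^ n)%R).
    intros n; now rewrite Im_RtoC_mult.
  apply G; trivial; intros n; apply Rle_trans with (2 := H n); apply Rabs_Im_le_Cmod.
Qed.

(** Weierstrass test: [sin u ^ 2 <= 1] makes [|a n|] a majorant on the whole line. The boundary of
    the disc of convergence is thereby included. *)
Lemma continuous_pseries_sin (a : nat -> R) (t : R) :
  ex_series (fun n => Rabs (a n)) -> continuous (fun u => PSeries a (sin u ^ 2)) t.
Proof.
intros H.
set (fn := fun n u => (a n * (sin u ^ 2) ^ n)%R).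
assert (B : forall n u, (Rabs (fn n u) <= Rabs (a n))%R).
  intros n u; unfold fn; rewrite Rabs_mult.
  rewrite <- (Rmult_1_r (Rabs (a n))) at 2; apply Rmult_le_compat_l; [apply Rabs_pos|].
  rewrite <- RPow_abs, <- (pow1 n); apply pow_incr; split; [apply Rabs_pos|].
  rewrite Rabs_pos_eq by apply pow2_ge_0.
  assert (S2 := sin2_cos2 u); unfold Rsqr in S2; nra.
assert (N : CVN_R fn).
  intros r; exists (fun n => Rabs (a n)), (Series (fun n => Rabs (a n))); split.
  - apply (is_lim_seq_Reals (sum_f_R0 _)).
    apply is_lim_seq_ext with (sum_n (fun n => Rabs (a n))).
      intros n; rewrite sum_n_Reals; apply sum_eq; intros i _; now rewrite Rabs_Rabsolu.
    exact (Series_correct _ H).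
  - intros n y _; apply B.
assert (K := SFL_continuity fn (CVN_R_CVS fn N) N).
apply (continuous_ext (SFL fn (CVN_R_CVS fn N))).
- intros u; symmetry; apply is_series_unique.
  unfold SFL; destruct (CVN_R_CVS fn N u) as [l Hl].
  apply is_lim_seq_Reals in Hl.
  refine (is_lim_seq_ext _ _ _ _ Hl).
  intros n; unfold SP; now rewrite <- sum_n_Reals.
- apply continuity_pt_filterlim, K; intros n u; unfold fn; apply derivable_continuous_pt; reg.
Qed.

Lemma C_continuous_pseries_sin (a : nat -> C) :
  ex_series (fun n => Cmod (a n)) -> C_continuous (fun u => C_pseries a (sin u ^ 2)).
Proof.
intros H t; split; simpl; apply continuous_pseries_sin;
  refine (ex_series_le (V := R_CompleteNormedModule) _ _ _ H); intros n;
  change (norm (Rabs ?x)) with (Rabs (Rabs x)); rewrite Rabs_Rabsolu;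
  [apply re_le_Cmod|apply Rabs_Im_le_Cmod].
Qed.

(** * The arcsine series *)

(** A function constant inside the interval has derivative 0 there, so the mean value argument
    already carries the value to the endpoint. *)
Lemma C_locally_const_1 (f : R -> C) (c : C) :
  (forall s, (Rabs s < 1)%R -> f s = c) ->
  C_continuous (fun u => f (sin u)) -> f 1%R = c.
Proof.
intros H Hc; rewrite <- (H 0%R) by (rewrite Rabs_R0; lra).
apply C_is_derive_0_const_1; [|exact Hc].
intros s Hs.
assert (L : locally s (fun u => c = f u)).
  assert (P : (0 < 1 - Rabs s)%R) by lra.
  exists (mkposreal _ P); intros u Hu; symmetry; apply H.
  change (Rabs (u - s) < 1 - Rabs s)%R in Hu.
  replace u with (u - s + s)%R by ring.
  apply Rle_lt_trans with (1 := Rabs_triang _ _); lra.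
split.
- apply (is_derive_ext_loc (fun _ => Re c)).
    apply (filter_imp _ _ (fun u (E : c = f u) => f_equal Re E) L).
  exact (is_derive_const (K := R_AbsRing) (V := R_NormedModule) (Re c) s).
- apply (is_derive_ext_loc (fun _ => Im c)).
    apply (filter_imp _ _ (fun u (E : c = f u) => f_equal Im E) L).
  exact (is_derive_const (K := R_AbsRing) (V := R_NormedModule) (Im c) s).
Qed.

Lemma Rabs_pow2_lt_1 (t : R) : (Rabs t < 1)%R -> (Rabs (t ^ 2) < 1)%R.
Proof.
intros H; rewrite <- RPow_abs; assert (P := Rabs_pos t); simpl; nra.
Qed.

(** Coefficients of the binomial series of [(1 - s z)^(-1/2)] in powers of [s]. *)
Definition inv_sqrt_coef (z : C) (j : nat) : C := RtoC (half_coef j) * z ^ j.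

Lemma Cmod_inv_sqrt_coef (z : C) (j : nat) :
  (Cmod z <= 1)%R -> (Cmod (inv_sqrt_coef z j) <= 1)%R.
Proof.
intros Hz; unfold inv_sqrt_coef; rewrite Cmod_mult, Cmod_R.
assert (K := half_coef_pos j); assert (L := half_coef_le_1 j).
rewrite Rabs_pos_eq by lra.
assert (M := Cmod_pow_le_1 z j Hz); assert (N := Cmod_ge_0 (z ^ j)); nra.
Qed.

Lemma Cmod_arcsin_coef_le_1 (m : nat) (z : C) (j : nat) :
  (1 <= m)%nat -> (Cmod z <= 1)%R -> (Cmod (arcsin_coef m z j) <= 1)%R.
Proof.
intros Hm Hz; apply Rle_trans with (1 := Cmod_arcsin_coef m z j Hm Hz).
assert (L := half_coef_le_1 j); assert (P := pos_INR j).
replace (2 * (half_coef j / (2 * INR j + 2)))%R with (half_coef j / (INR j + 1))%R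
  by (field; lra).
apply Rle_div_l; lra.
Qed.

Lemma ex_series_arcsin_coef (m : nat) (z : C) :
  (1 <= m)%nat -> (Cmod z <= 1)%R -> ex_series (fun j => Cmod (arcsin_coef m z j)).
Proof.
intros Hm Hz.
refine (ex_series_le (V := R_CompleteNormedModule) _ _ _
  (ex_series_scal_l (K := R_AbsRing) (V := R_NormedModule) 2%R _ ex_series_half_coef)).
intros j; change (norm (Cmod ?c)) with (Rabs (Cmod c)).
rewrite Rabs_pos_eq by apply Cmod_ge_0; now apply Cmod_arcsin_coef.
Qed.

(* If [z = x^2], then [x^m] times this is the integral of [sin^(m-1)] from 0 to [arcsin (t x)]. *)
Definition arcsin_primitive (m : nat) (z : C) (t : R) : C :=
  RtoC t ^ m * C_pseries (arcsin_coef m z) (t ^ 2).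

(** Differentiating [t^(2j+m)] cancels the denominator [2j+m]. What is left is [t^p] times the
    derivative for [m = 1], which is how a power of the sine enters the integrand. *)
Lemma arcsin_primitive_is_derive (p : nat) (z : C) (t : R) :
  (Cmod z <= 1)%R -> (Rabs t < 1)%R ->
  C_is_derive (arcsin_primitive (S p) z) t
    (RtoC t ^ p * C_pseries (inv_sqrt_coef z) (t ^ 2)).
Proof.
intros Hz Ht; assert (Ht2 := Rabs_pow2_lt_1 t Ht).
set (a := arcsin_coef (S p) z).
assert (B : forall n, (Cmod (a n) <= 1)%R).
  intros n; apply Cmod_arcsin_coef_le_1; [lia|exact Hz].
(* The factor [2j + m] is split as the product rule produces it: [m] comes from [t^m], and [2j] from
   the series in [t^2]. *)
assert (E : C_pseries (inv_sqrt_coef z) (t ^ 2) =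
    RtoC (INR (S p)) * C_pseries a (t ^ 2) +
    2 * C_pseries (fun n => RtoC (INR n) * a n) (t ^ 2)).
  rewrite <- C_pseries_linear
    by solve [apply C_ex_pseries_bounded; assumption|apply C_ex_pseries_deriv; assumption].
  apply C_pseries_ext; intros n; unfold a, arcsin_coef, inv_sqrt_coef.
  assert (P := pos_INR n); assert (Q := pos_INR p).
  transitivity (RtoC ((2 * INR n + INR (S p)) * (half_coef n / (2 * INR n + INR (S p)))) * z ^ n).
    do 2 f_equal; rewrite S_INR; field; lra.
  rewrite RtoC_mult, RtoC_plus, RtoC_mult; ring.
rewrite E, <- mult_C_pseries_deriv.
refine (C_is_derive_eq _ _ _ _ (C_is_derive_mult _ _ _ _ _ (C_is_derive_pow t p)
  (C_is_derive_comp (C_pseries a) (fun s => s ^ 2)%R t _ (2 * t)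
    (C_pseries_is_derive a _ B Ht2) _)) _).
- auto_derive; [trivial|ring].
- rewrite RtoC_pow, RtoC_mult, Cpow_S; simpl (_ ^ 2); ring.
Qed.

Lemma arcsin_primitive_continuous (m : nat) (z : C) :
  (1 <= m)%nat -> (Cmod z <= 1)%R -> C_continuous (fun u => arcsin_primitive m z (sin u)).
Proof.
intros Hm Hz; apply C_continuous_mult.
- apply (C_continuous_ext (fun u => RtoC (sin u ^ m)%R)).
    intros u; apply RtoC_pow.
  apply C_continuous_RtoC; intros u; apply continuity_pt_filterlim.
  apply derivable_continuous_pt; reg.
- now apply C_continuous_pseries_sin, ex_series_arcsin_coef.
Qed.

Lemma arcsin_primitive_0 (p : nat) (z : C) : arcsin_primitive (S p) z 0 = 0.
Proof. unfold arcsin_primitive; rewrite Cpow_S; ring. Qed.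

(** This is the recurrence [(j+1) c_(j+1) = (j + 1/2) c_j] written as a differential equation. *)
Lemma inv_sqrt_series_ode (z : C) (s : R) :
  (Cmod z <= 1)%R -> (Rabs s < 1)%R ->
  (1 - RtoC s * z) * C_pseries (C_deriv_coef (inv_sqrt_coef z)) s =
  z / 2 * C_pseries (inv_sqrt_coef z) s.
Proof.
intros Hz Hs.
set (y := inv_sqrt_coef z).
assert (B : forall n, (Cmod (y n) <= 1)%R).
  intros n; now apply Cmod_inv_sqrt_coef.
assert (E : C_pseries (C_deriv_coef y) s =
    z * C_pseries (fun n => RtoC (INR n) * y n) s + z / 2 * C_pseries y s).
  rewrite <- C_pseries_linear
    by solve [apply C_ex_pseries_bounded; assumption|apply C_ex_pseries_deriv; assumption].
  apply C_pseries_ext; intros n; unfold C_deriv_coef, y, inv_sqrt_coef.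
  assert (P := pos_INR n).
  rewrite Cpow_S.
  transitivity (RtoC (half_coef n * (INR n + / 2)) * (z * z ^ n)).
    rewrite Cmult_assoc, <- RtoC_mult; do 2 f_equal; simpl half_coef; rewrite S_INR; field; lra.
  rewrite RtoC_mult, RtoC_plus, RtoC_inv by lra; field.
transitivity (C_pseries (C_deriv_coef y) s - z * (RtoC s * C_pseries (C_deriv_coef y) s)); [ring|].
rewrite mult_C_pseries_deriv, E; field.
Qed.

(** By the differential equation the left side has derivative 0, and it is 1 at [s = 0]. The series
    is thus an inverse square root of [1 - s z] obtained without choosing a branch. *)
Lemma inv_sqrt_series_sqr (z : C) (s : R) :
  (Cmod z <= 1)%R -> (Rabs s < 1)%R ->
  (1 - RtoC s * z) * (C_pseries (inv_sqrt_coef z) s * C_pseries (inv_sqrt_coef z) s) = 1.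
Proof.
intros Hz Hs.
set (f := fun u : R => (1 + - z * RtoC u) *
  (C_pseries (inv_sqrt_coef z) u * C_pseries (inv_sqrt_coef z) u)).
transitivity (f s); [unfold f; ring|].
transitivity (f 0%R).
2: { unfold f; rewrite C_pseries_0; unfold inv_sqrt_coef; simpl; ring. }
apply C_is_derive_0_const; [clear s Hs; intros s Hs|exact Hs].
assert (D := C_pseries_is_derive _ _ (fun n => Cmod_inv_sqrt_coef z n Hz) Hs).
refine (C_is_derive_eq _ _ _ _ (C_is_derive_mult _ _ _ _ _
  (C_is_derive_plus _ _ _ _ _ (C_is_derive_const 1 s)
    (C_is_derive_scal (- z) _ _ _ (C_is_derive_RtoC (fun u => u) s 1 (is_derive_id (K := R_AbsRing) s))))
  (C_is_derive_mult _ _ _ _ _ D D)) _).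
assert (E := inv_sqrt_series_ode z s Hz Hs).
set (Y := C_pseries (inv_sqrt_coef z) s) in *.
set (Y' := C_pseries (C_deriv_coef (inv_sqrt_coef z)) s) in *.
transitivity (- z * (Y * Y) + 2 * Y * ((1 - RtoC s * z) * Y')); [ring|].
rewrite E; field.
Qed.

(** With [Y] the inverse square root series at [t^2], the product [(1 - t^2 z) Y] plays the role of
    [sqrt (1 - t^2 z)]. The right side [Q] satisfies [Q' = i x Y Q], where [x Y] is the derivative
    of [x * arcsin_primitive 1 z]; so [Q] times the inverse exponential is constant, equal to its
    value 1 at 0. *)
Lemma Cexp_arcsin_primitive (z x : C) (t : R) :
  x * x = z -> (Cmod z <= 1)%R -> (Rabs t < 1)%R ->
  Cexp (Ci * (x * arcsin_primitive 1 z t)) =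
  (1 - RtoC (t ^ 2) * z) * C_pseries (inv_sqrt_coef z) (t ^ 2) + Ci * (RtoC t * x).
Proof.
intros Hx Hz Ht.
set (Q := fun s : R => (1 + - z * RtoC (s ^ 2)) * C_pseries (inv_sqrt_coef z) (s ^ 2)
  + Ci * x * RtoC s).
set (A := fun s : R => - (Ci * x) * arcsin_primitive 1 z s).
assert (E : Q t * Cexp (A t) = 1).
  transitivity (Q 0%R * Cexp (A 0%R)).
  2: { unfold Q, A; rewrite arcsin_primitive_0.
    replace (0 ^ 2)%R with 0%R by ring; rewrite C_pseries_0.
    replace (- (Ci * x) * 0) with (RtoC 0) by ring; rewrite Cexp_0.
    unfold inv_sqrt_coef; simpl; ring. }
  apply (C_is_derive_0_const (fun s => Q s * Cexp (A s))); [clear t Ht; intros t Ht|exact Ht].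
  assert (Ht2 := Rabs_pow2_lt_1 t Ht).
  assert (S2 : is_derive (fun s => s ^ 2)%R t (2 * t)%R) by (auto_derive; [trivial|ring]).
  refine (C_is_derive_eq _ _ _ _ (C_is_derive_mult _ _ _ _ _
    (C_is_derive_plus _ _ _ _ _
      (C_is_derive_mult _ _ _ _ _
        (C_is_derive_plus _ _ _ _ _ (C_is_derive_const 1 t)
          (C_is_derive_scal (- z) _ _ _ (C_is_derive_RtoC _ _ _ S2)))
        (C_is_derive_comp _ _ _ _ _
          (C_pseries_is_derive _ _ (fun n => Cmod_inv_sqrt_coef z n Hz) Ht2) S2))
      (C_is_derive_scal (Ci * x) _ _ _
        (C_is_derive_RtoC (fun u => u) t 1 (is_derive_id (K := R_AbsRing) t))))
    (C_is_derive_Cexp _ _ _ (C_is_derive_scal _ _ _ _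
      (arcsin_primitive_is_derive 0 z t Hz Ht)))) _).
  assert (E1 := inv_sqrt_series_ode z _ Hz Ht2).
  assert (E2 := inv_sqrt_series_sqr z _ Hz Ht2).
  unfold Q.
  set (Y := C_pseries (inv_sqrt_coef z) (t ^ 2)) in *.
  set (Y' := C_pseries (C_deriv_coef (inv_sqrt_coef z)) (t ^ 2)) in *.
  set (X := Cexp (A t)).
  rewrite RtoC_mult.
  (* Grouped so that the differential equation, [(1 - s z) Y^2 = 1], [i^2 = -1] and [x^2 = z] each
     apply to a visible subterm. *)
  transitivity ((- (2 * t * z) * Y + 2 * t * ((1 - RtoC (t ^ 2) * z) * Y') + Ci * x
    - Ci * x * ((1 - RtoC (t ^ 2) * z) * (Y * Y))
    - (Ci * Ci) * (x * x) * t * Y) * X).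
    simpl (_ ^ 0); fold (A t); fold X; ring.
  rewrite E1, E2, Ci_sqr, Hx; field.
transitivity (Q t * Cexp (A t) * Cexp (Ci * (x * arcsin_primitive 1 z t))).
- rewrite E; ring.
- transitivity (Q t * (Cexp (A t) * Cexp (- A t))).
    replace (- A t) with (Ci * (x * arcsin_primitive 1 z t)) by (unfold A; ring); ring.
  rewrite Cexp_mult_opp; unfold Q; ring.
Qed.

(** As [- x] is also a square root of [z], the preceding identity gives both exponentials; their
    root terms agree and cancel in the difference. *)
Lemma Csin_arcsin_primitive (z x : C) (t : R) :
  x * x = z -> (Cmod z <= 1)%R -> (Rabs t < 1)%R ->
  Csin (x * arcsin_primitive 1 z t) = RtoC t * x.
Proof.
intros Hx Hz Ht; unfold Csin.
rewrite (Cexp_arcsin_primitive z x t Hx Hz Ht).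
replace (- (Ci * (x * arcsin_primitive 1 z t)))
  with (Ci * (- x * arcsin_primitive 1 z t)) by ring.
rewrite (Cexp_arcsin_primitive z (- x) t); trivial.
- field; apply Ci_nz.
- rewrite <- Hx; ring.
Qed.

(** * The endpoint [t = 1] and the principal branch *)

Lemma C_continuous_Ccos (f : R -> C) :
  C_continuous f -> C_continuous (fun s => Ccos (f s)).
Proof.
intros H; unfold Ccos, Cdiv; apply C_continuous_mult; [|apply C_continuous_const].
apply C_continuous_plus; apply C_continuous_Cexp.
- apply C_continuous_mult; [apply C_continuous_const|exact H].
- apply (C_continuous_ext (fun s => - Ci * f s)).
    intros s; ring.
  apply C_continuous_mult; [apply C_continuous_const|exact H].
Qed.

Lemma C_continuous_Csin (f : R -> C) :
  C_continuous f -> C_continuous (fun s => Csin (f s)).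
Proof.
intros H; unfold Csin, Cdiv; apply C_continuous_mult; [|apply C_continuous_const].
apply (C_continuous_ext (fun s => Cexp (Ci * f s) + -1 * Cexp (- Ci * f s))).
  intros s; replace (- Ci * f s) with (- (Ci * f s)) by ring; ring.
apply C_continuous_plus; [|apply C_continuous_mult; [apply C_continuous_const|]];
  apply C_continuous_Cexp; apply C_continuous_mult; trivial; apply C_continuous_const.
Qed.

Lemma Csin_arcsin_primitive_1 (z x : C) :
  x * x = z -> (Cmod z <= 1)%R -> Csin (x * arcsin_primitive 1 z 1) = x.
Proof.
intros Hx Hz.
set (f := fun t : R => Csin (x * arcsin_primitive 1 z t) + - x * RtoC t).
assert (E : f 1%R = 0).
  apply C_locally_const_1.
  - intros s Hs; unfold f; rewrite Csin_arcsin_primitive by trivial; ring.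
  - apply C_continuous_plus.
    + apply C_continuous_Csin, C_continuous_mult; [apply C_continuous_const|].
      now apply arcsin_primitive_continuous.
    + apply C_continuous_mult; [apply C_continuous_const|].
      apply C_continuous_RtoC; intros u; apply continuous_sin.
transitivity (f 1%R + x); [unfold f; ring|]; rewrite E; ring.
Qed.

Lemma Re_le_1 (z : C) : (Cmod z <= 1)%R -> (Re z <= 1)%R.
Proof.
intros H; apply Rle_trans with (2 := H), Rle_trans with (2 := re_le_Cmod z); apply Rle_abs.
Qed.

(** The cosine [w] starts at 1. Were [Re w] negative at the end, it would vanish at some [t < 1];
    there [w^2 = 1 - t^2 z] has real part [- (Im w)^2 <= 0], whereas [Re z <= 1] makes it
    positive. *)
Lemma Re_Ccos_arcsin_primitive_1 (z x : C) :
  x * x = z -> (Cmod z <= 1)%R -> (0 <= Re (Ccos (x * arcsin_primitive 1 z 1)))%R.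
Proof.
intros Hx Hz; apply Rnot_lt_le; intros L.
set (h := fun u => Re (Ccos (x * arcsin_primitive 1 z (sin u)))).
assert (Hc : continuity h).
  intros u; apply continuity_pt_filterlim.
  assert (K : C_continuous (fun u => Ccos (x * arcsin_primitive 1 z (sin u)))).
    apply C_continuous_Ccos, C_continuous_mult; [apply C_continuous_const|].
    now apply arcsin_primitive_continuous.
  apply K.
assert (HP := PI_RGT_0).
assert (H0 : h 0%R = 1%R).
  unfold h; rewrite sin_0, arcsin_primitive_0.
  unfold Ccos; replace (Ci * (x * 0)) with (RtoC 0) by ring.
  replace (- RtoC 0) with (RtoC 0) by ring.
  rewrite Cexp_0; replace ((1 + 1) / 2) with (RtoC 1) by field; reflexivity.
assert (H1 : (h (PI / 2) < 0)%R) by (unfold h; rewrite sin_PI2; exact L).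
destruct (IVT_cor h 0 (PI / 2) Hc) as [u [[Hu1 Hu2] Hu]]; [lra|nra|].
destruct (Req_dec u (PI / 2)) as [->|N]; [lra|].
assert (Ht : (0 <= sin u < 1)%R) by (apply sin_lt_1; lra).
unfold h in Hu; set (t := sin u) in *.
assert (Ha : (Rabs t < 1)%R) by (apply Rabs_def1; lra).
assert (E := Csin_sqr_add_Ccos_sqr (x * arcsin_primitive 1 z t)).
rewrite Csin_arcsin_primitive in E by trivial.
set (w := Ccos (x * arcsin_primitive 1 z t)) in *.
assert (E' : RtoC (t * t) * z + w * w = 1).
  rewrite <- E, <- Hx, RtoC_mult; ring.
apply (f_equal Re) in E'.
change (Re (RtoC (t * t) * z) + Re (w * w) = 1)%R in E'.
rewrite Re_RtoC_mult in E'.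
change (Re (w * w)) with (Re w * Re w - Im w * Im w)%R in E'.
rewrite Hu in E'; assert (R1 := Re_le_1 z Hz).
assert (0 <= t * t < 1)%R by nra; nra.
Qed.

(** The majorant sums to at most 2, which bounds the real and the imaginary part; the modulus is
    then at most [2 sqrt 2 < 3]. *)
Lemma Cmod_arcsin_primitive_1 (z : C) :
  (Cmod z <= 1)%R -> (Cmod (arcsin_primitive 1 z 1) < 3)%R.
Proof.
intros Hz; unfold arcsin_primitive.
rewrite pow1, Cpow_1_l, Cmult_1_l.
assert (Hs := ex_series_arcsin_coef 1 z (le_n 1) Hz).
assert (B : (Series (fun j => Cmod (arcsin_coef 1 z j)) <= 2)%R).
  apply Rle_trans with (Series (fun j => 2 * (half_coef j / (2 * INR j + 2)))%R).
  - apply Series_le.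
      intros n; split; [apply Cmod_ge_0|now apply Cmod_arcsin_coef].
    exact (ex_series_scal_l (K := R_AbsRing) (V := R_NormedModule) 2%R _ ex_series_half_coef).
  - rewrite Series_scal_l; assert (K := Series_half_coef); lra.
assert (G : forall r : nat -> R, (forall j, Rabs (r j) <= Cmod (arcsin_coef 1 z j))%R ->
    (Rabs (PSeries r 1) <= 2)%R).
  intros r Hr; rewrite PSeries_1; apply Rle_trans with (2 := B).
  apply Rle_trans with (Series (fun j => Rabs (r j))).
  - apply Series_Rabs.
    refine (ex_series_le (V := R_CompleteNormedModule) _ _ _ Hs); intros n.
    change (norm (Rabs ?x)) with (Rabs (Rabs x)); rewrite Rabs_Rabsolu; apply Hr.
  - apply Series_le; [|exact Hs]; intros n; split; [apply Rabs_pos|apply Hr].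
apply Rle_lt_trans with (1 := Cmod_2Rmax _).
assert (M : (Rmax (Rabs (fst (C_pseries (arcsin_coef 1 z) 1)))
    (Rabs (snd (C_pseries (arcsin_coef 1 z) 1))) <= 2)%R).
  apply Rmax_lub; unfold C_pseries, fst, snd; apply G; intros j; [apply re_le_Cmod|apply Rabs_Im_le_Cmod].
assert (Q : (sqrt 2 < 3 / 2)%R).
  rewrite <- (sqrt_Rsqr (3 / 2)) by lra; apply sqrt_lt_1; unfold Rsqr; lra.
assert (S0 := sqrt_pos 2); nra.
Qed.

Lemma Carcsin_series (z x : C) :
  x * x = z -> (Cmod z <= 1)%R -> Carcsin x = x * arcsin_primitive 1 z 1.
Proof.
intros Hx Hz.
assert (S := Csin_arcsin_primitive_1 z x Hx Hz).
assert (P := Re_Ccos_arcsin_primitive_1 z x Hx Hz).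
assert (E := Csin_sqr_add_Ccos_sqr (x * arcsin_primitive 1 z 1)).
rewrite <- S at 1; apply Carcsin_Csin.
- assert (X : (Cmod x <= 1)%R).
    assert (N := Cmod_ge_0 x); apply (f_equal Cmod) in Hx; rewrite Cmod_mult in Hx; nra.
  assert (B : (Cmod (x * arcsin_primitive 1 z 1) < 3)%R).
    rewrite Cmod_mult; assert (K := Cmod_arcsin_primitive_1 z Hz).
    assert (N := Cmod_ge_0 (arcsin_primitive 1 z 1)); nra.
  assert (PB := PI2_3_2).
  assert (A := re_le_Cmod (x * arcsin_primitive 1 z 1)); apply Rabs_le_between in A; lra.
- rewrite S in E |- *; set (w := Ccos (x * arcsin_primitive 1 z 1)) in *.
  replace (1 - x ^ 2) with (w * w).
  2: { rewrite <- E; simpl; ring. }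
  (* On the boundary [Re w = 0], the relation [w^2 = 1 - z] with [Re z <= 1] forces [w = 0], that is
     [z = 1]. *)
  destruct (Req_dec (Re w) 0) as [W|W]; [|apply Csqrt_unique; lra].
  assert (w = 0) as ->.
    rewrite Hx in E; apply (f_equal Re) in E.
    change (Re z + (Re w * Re w - Im w * Im w) = 1)%R in E.
    assert (R1 := Re_le_1 z Hz).
    apply C_eq; [exact W|]; change (Im w = 0)%R.
    assert (I : (Im w * Im w = 0)%R) by (rewrite W in E; assert (N := Rle_0_sqr (Im w)); unfold Rsqr in N; lra).
    now destruct (Rmult_integral _ _ I).
  replace (0 * 0) with (RtoC 0) by ring; apply Csqrt_0.
Qed.

(** * Integrals of powers of the sine *)

Lemma C_is_derive_Csin (f : R -> C) (t : R) (df : C) :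
  C_is_derive f t df -> C_is_derive (fun s => Csin (f s)) t (df * Ccos (f t)).
Proof.
intros H.
assert (H1 := C_is_derive_Cexp _ _ _ (C_is_derive_scal Ci _ _ _ H)).
assert (H2 := C_is_derive_Cexp _ _ _ (C_is_derive_scal (- Ci) _ _ _ H)).
apply (C_is_derive_ext (fun s => / (2 * Ci) * (Cexp (Ci * f s) + -1 * Cexp (- Ci * f s)))).
  intros s; unfold Csin; replace (- Ci * f s) with (- (Ci * f s)) by ring.
  field; apply Ci_nz.
refine (C_is_derive_eq _ _ _ _ (C_is_derive_scal _ _ _ _
  (C_is_derive_plus _ _ _ _ _ H1 (C_is_derive_scal (-1) _ _ _ H2))) _).
unfold Ccos; replace (- Ci * f t) with (- (Ci * f t)) by ring; field; apply Ci_nz.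
Qed.

Lemma C_is_derive_Ccos (f : R -> C) (t : R) (df : C) :
  C_is_derive f t df -> C_is_derive (fun s => Ccos (f s)) t (- df * Csin (f t)).
Proof.
intros H.
assert (H1 := C_is_derive_Cexp _ _ _ (C_is_derive_scal Ci _ _ _ H)).
assert (H2 := C_is_derive_Cexp _ _ _ (C_is_derive_scal (- Ci) _ _ _ H)).
apply (C_is_derive_ext (fun s => / 2 * (Cexp (Ci * f s) + Cexp (- Ci * f s)))).
  intros s; unfold Ccos; replace (- Ci * f s) with (- (Ci * f s)) by ring; field.
refine (C_is_derive_eq _ _ _ _ (C_is_derive_scal _ _ _ _
  (C_is_derive_plus _ _ _ _ _ H1 H2)) _).
unfold Csin; replace (- Ci * f t) with (- (Ci * f t)) by ring.
transitivity (/ 2 * ((- (Ci * Ci)) * df * (/ Ci * Cexp (Ci * f t) - / Ci * Cexp (- (Ci * f t)))) * -1).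
  field; apply Ci_nz.
rewrite Ci_sqr; field; apply Ci_nz.
Qed.

Lemma Csin_0 : Csin 0 = 0.
Proof.
unfold Csin; replace (- (Ci * 0)) with (Ci * 0) by ring; field; apply Ci_nz.
Qed.

Lemma Ccos_0 : Ccos 0 = 1.
Proof.
unfold Ccos; replace (- (Ci * 0)) with (Ci * 0) by ring.
replace (Ci * 0) with (RtoC 0) by ring; rewrite Cexp_0; field.
Qed.

Lemma Csum_zero (f : nat -> C) (n : nat) : (forall k, f k = 0) -> sum_n f n = 0 :> C.
Proof.
intros H; rewrite (Csum_ext f (fun k => 0 * f k)), Csum_scal; [ring|].
intros k _; rewrite H; ring.
Qed.

Lemma RtoC_INR_minus_neq_0 (n k : nat) : k <> n -> RtoC (INR n) - RtoC (INR k) <> 0.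
Proof.
intros H E; rewrite <- RtoC_minus in E; apply RtoC_inj in E; apply H, INR_eq; lra.
Qed.

(** Both sides are primitives of [4^n sin^(2n)] along the path [x * arcsin_primitive 1 z t], whose
    sine is [t x], and both vanish at [t = 0]. The term [k = n] of the linearised power has
    frequency 0 and integrates to the arcsine itself, hence its separate place. *)
Lemma arcsin_primitive_even (n : nat) (z x : C) :
  x * x = z -> (Cmod z <= 1)%R ->
  4 ^ n * (x ^ (2 * n + 1) * arcsin_primitive (2 * n + 1) z 1) =
  binom (2 * n) n * Carcsin x +
  (-1) ^ n * sum_n (fun k => if Nat.eq_dec k n then RtoC 0 else
    (-1) ^ k * binom (2 * n) k *
    (Csin (2 * (INR n - INR k) * Carcsin x) / (2 * (INR n - INR k)))) (2 * n).
Proof.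
intros Hx Hz; rewrite (Carcsin_series z x Hx Hz).
replace (2 * n + 1)%nat with (S (2 * n)) by lia.
set (A := fun t : R => x * arcsin_primitive 1 z t).
set (g := fun k t => if Nat.eq_dec k n then RtoC 0 else
  (-1) ^ k * binom (2 * n) k * / (2 * (INR n - INR k)) * Csin (2 * (INR n - INR k) * A t)).
set (f := fun t : R => 4 ^ n * x ^ S (2 * n) * arcsin_primitive (S (2 * n)) z t +
  - (1) * (binom (2 * n) n * A t + (-1) ^ n * sum_n (fun k => g k t) (2 * n))).
assert (E : f 1%R = 0).
2: { apply Ceq_minus; transitivity (f 1%R); [|exact E]; unfold f, A.
  rewrite (Csum_ext (fun k => g k 1%R) (fun k => if Nat.eq_dec k n then RtoC 0 else
    (-1) ^ k * binom (2 * n) k *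
    (Csin (2 * (INR n - INR k) * (x * arcsin_primitive 1 z 1)) / (2 * (INR n - INR k))))).
    set (S0 := sum_n _ _); ring.
  intros k _; unfold g, A; destruct (Nat.eq_dec k n) as [e|e]; [reflexivity|].
  field; now apply RtoC_INR_minus_neq_0. }
transitivity (f 0%R).
2: { unfold f, A; rewrite !arcsin_primitive_0, Csum_zero; [ring|].
  intros k; unfold g, A; rewrite arcsin_primitive_0; destruct (Nat.eq_dec k n); [reflexivity|].
  replace (2 * (INR n - INR k) * (x * 0)) with (RtoC 0) by ring; rewrite Csin_0; ring. }
apply C_is_derive_0_const_1.
- intros t Ht.
  assert (DA := C_is_derive_scal x _ _ _ (arcsin_primitive_is_derive 0 z t Hz Ht)).
  set (Y := C_pseries (inv_sqrt_coef z) (t ^ 2)) in DA.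
  assert (Dg : forall k, C_is_derive (g k) t (x * Y * (if Nat.eq_dec k n then RtoC 0 else
      (-1) ^ k * binom (2 * n) k * Ccos (2 * (INR n - INR k) * A t)))).
    intros k; unfold g; destruct (Nat.eq_dec k n) as [e|e].
      refine (C_is_derive_eq _ _ _ _ (C_is_derive_const 0 t) _); ring.
    refine (C_is_derive_eq _ _ _ _ (C_is_derive_scal _ _ _ _ (C_is_derive_Csin _ _ _
      (C_is_derive_scal _ _ _ _ DA))) _).
    simpl (_ ^ 0); fold (A t); field; now apply RtoC_INR_minus_neq_0.
  refine (C_is_derive_eq _ _ _ _ (C_is_derive_plus _ _ _ _ _
    (C_is_derive_scal _ _ _ _ (arcsin_primitive_is_derive (2 * n) z t Hz Ht))
    (C_is_derive_scal _ _ _ _ (C_is_derive_plus _ _ _ _ _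
      (C_is_derive_scal _ _ _ _ DA)
      (C_is_derive_scal _ _ _ _ (C_is_derive_sum _ _ _ (2 * n) Dg))))) _).
  rewrite Csum_scal; fold Y; simpl (_ ^ 0).
  assert (P := Csin_pow_even (A t) n).
  rewrite (Csum_remove _ n) in P by lia.
  replace (2 * (INR n - INR n) * A t) with (RtoC 0) in P by ring.
  rewrite Ccos_0 in P; unfold A at 1 in P; rewrite Csin_arcsin_primitive in P by trivial.
  rewrite Cpow_mult_l in P.
  set (S0 := sum_n _ _) in *.
  assert (Q := Copp1_pow_sqr n).
  rewrite Cpow_S.
  transitivity (x * Y * (4 ^ n * (RtoC t ^ (2 * n) * x ^ (2 * n)) -
    (binom (2 * n) n + (-1) ^ n * S0))); [ring|].
  rewrite P.
  (* The middle term carries the sign [(-1)^n] of its index, which the prefactor [(-1)^n] undoes. *)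
  transitivity (x * Y * binom (2 * n) n * ((-1) ^ n * (-1) ^ n - 1)); [ring|].
  rewrite Q; ring.
- assert (CA : C_continuous (fun u => A (sin u))).
    apply C_continuous_mult; [apply C_continuous_const|].
    now apply arcsin_primitive_continuous.
  assert (K : forall c h, C_continuous h -> C_continuous (fun u => c * h u)).
    intros c h Hh; apply C_continuous_mult; [apply C_continuous_const|exact Hh].
  unfold f; apply C_continuous_plus; [|apply K, C_continuous_plus].
  + apply K, arcsin_primitive_continuous; [lia|exact Hz].
  + now apply K.
  + apply K, C_continuous_sum; intros k; unfold g; destruct (Nat.eq_dec k n).
      apply C_continuous_const.
    now apply K, C_continuous_Csin, K.
Qed.

Lemma odd_frequency_neq_0 (n k : nat) : 2 * RtoC (INR n) - 2 * RtoC (INR k) + 1 <> 0.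
Proof.
intros E; rewrite <- !RtoC_mult, <- RtoC_minus, <- RtoC_plus in E; apply RtoC_inj in E.
assert (H : INR (2 * n + 1) = INR (2 * k)).
  rewrite plus_INR, !mult_INR; simpl; lra.
apply INR_eq in H; lia.
Qed.

(** Here all frequencies are odd, so none vanishes and no term is set apart. The [- 1] next to each
    cosine makes the primitive of the sine vanish at 0, and integrating a sine turns [(-1)^n] into
    [(-1)^(1+n)]. *)
Lemma arcsin_primitive_odd (n : nat) (z x : C) :
  x * x = z -> (Cmod z <= 1)%R ->
  4 ^ n * (x ^ (2 * n + 2) * arcsin_primitive (2 * n + 2) z 1) =
  (-1) ^ (1 + n) / 2 * sum_n (fun k => (-1) ^ k * binom (1 + 2 * n) k *
    ((Ccos ((2 * INR n - 2 * INR k + 1) * Carcsin x) - 1) /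
     (2 * INR n - 2 * INR k + 1))) (1 + 2 * n).
Proof.
intros Hx Hz; rewrite (Carcsin_series z x Hx Hz).
replace (2 * n + 2)%nat with (S (1 + 2 * n)) by lia.
set (A := fun t : R => x * arcsin_primitive 1 z t).
set (c := fun k : nat => 2 * INR n - 2 * INR k + 1).
set (g := fun k t => (-1) ^ k * binom (1 + 2 * n) k * / c k * (Ccos (c k * A t) + -1)).
set (f := fun t : R => 4 ^ n * x ^ S (1 + 2 * n) * arcsin_primitive (S (1 + 2 * n)) z t +
  (-1) ^ n / 2 * sum_n (fun k => g k t) (1 + 2 * n)).
assert (E : f 1%R = 0).
2: { apply Ceq_minus; transitivity (f 1%R); [|exact E]; unfold f, A.
  rewrite (Csum_ext (fun k => g k 1%R) (fun k => (-1) ^ k * binom (1 + 2 * n) k *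
    ((Ccos (c k * (x * arcsin_primitive 1 z 1)) - 1) / c k))).
    rewrite (Cpow_add_r (-1) 1 n), Cpow_1_r; unfold c; field.
  intros k _; unfold g, A; field; apply odd_frequency_neq_0. }
transitivity (f 0%R).
2: { unfold f, A; rewrite !arcsin_primitive_0, Csum_zero; [ring|].
  intros k; unfold g, A; rewrite arcsin_primitive_0.
  replace (c k * (x * 0)) with (RtoC 0) by ring; rewrite Ccos_0; ring. }
apply C_is_derive_0_const_1.
- intros t Ht.
  assert (DA := C_is_derive_scal x _ _ _ (arcsin_primitive_is_derive 0 z t Hz Ht)).
  set (Y := C_pseries (inv_sqrt_coef z) (t ^ 2)) in DA.
  assert (Dg : forall k, C_is_derive (g k) t (- (x * Y) *
      ((-1) ^ k * binom (1 + 2 * n) k * Csin (c k * A t)))).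
    intros k; unfold g.
    refine (C_is_derive_eq _ _ _ _ (C_is_derive_scal _ _ _ _ (C_is_derive_plus _ _ _ _ _
      (C_is_derive_Ccos _ _ _ (C_is_derive_scal _ _ _ _ DA)) (C_is_derive_const (-1) t))) _).
    simpl (_ ^ 0); fold (A t); field; apply odd_frequency_neq_0.
  refine (C_is_derive_eq _ _ _ _ (C_is_derive_plus _ _ _ _ _
    (C_is_derive_scal _ _ _ _ (arcsin_primitive_is_derive (1 + 2 * n) z t Hz Ht))
    (C_is_derive_scal _ _ _ _ (C_is_derive_sum _ _ _ (1 + 2 * n) Dg))) _).
  rewrite Csum_scal; fold Y.
  assert (P := Csin_pow_odd (A t) n).
  unfold A at 1 in P; rewrite Csin_arcsin_primitive in P by trivial.
  rewrite Cpow_mult_l in P; fold c in P.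
  rewrite Cpow_S.
  transitivity (x * Y * (4 ^ n * (RtoC t ^ (1 + 2 * n) * x ^ (1 + 2 * n)) -
    (-1) ^ n * / 2 * sum_n (fun k => (-1) ^ k * binom (1 + 2 * n) k *
    Csin (c k * A t)) (1 + 2 * n))); [field|].
  rewrite P; unfold c; ring.
- assert (CA : C_continuous (fun u => A (sin u))).
    apply C_continuous_mult; [apply C_continuous_const|].
    now apply arcsin_primitive_continuous.
  assert (K : forall c h, C_continuous h -> C_continuous (fun u => c * h u)).
    intros a h Hh; apply C_continuous_mult; [apply C_continuous_const|exact Hh].
  unfold f; apply C_continuous_plus.
  + apply K, arcsin_primitive_continuous; [lia|exact Hz].
  + apply K, C_continuous_sum; intros k; unfold g.
    apply K, C_continuous_plus; [|apply C_continuous_const].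
    now apply C_continuous_Ccos, K.
Qed.

(** * The hypergeometric series *)

Lemma pochhammer_one (j : nat) : pochhammer 1 j = RtoC (INR (fact j)).
Proof.
induction j as [|j IH]; [reflexivity|].
simpl pochhammer; rewrite IH, fact_simpl, mult_INR, RtoC_mult, S_INR, RtoC_plus; ring.
Qed.

(** Because [(1/2)_(j+1) = (1/2) (3/2)_j] and [(2)_j = (j+1)!]; this is where the index [j+1] comes
    from. *)
Lemma pochhammer_three_halves (j : nat) :
  pochhammer (3 / 2) j = RtoC (2 * half_coef (S j)) * pochhammer 2 j.
Proof.
induction j as [|j IH].
- simpl; replace (2 * (1 * ((2 * 0 + 1) / (2 * 0 + 2))))%R with 1%R by field; ring.
- change (pochhammer (3 / 2) (S j)) with (pochhammer (3 / 2) j * (3 / 2 + INR j)).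
  change (pochhammer 2 (S j)) with (pochhammer 2 j * (2 + INR j)).
  rewrite IH.
  transitivity (RtoC (2 * half_coef (S j) * (3 / 2 + INR j)) * pochhammer 2 j).
    rewrite !RtoC_mult, RtoC_plus, RtoC_div by lra; ring.
  transitivity (RtoC (2 * half_coef (S (S j)) * (2 + INR j)) * pochhammer 2 j).
  2: rewrite !RtoC_mult, RtoC_plus; ring.
  do 2 f_equal; change (half_coef (S (S j)))
    with (half_coef (S j) * ((2 * INR (S j) + 1) / (2 * INR (S j) + 2)))%R.
  assert (P := pos_INR j); rewrite S_INR; field; lra.
Qed.

Lemma pochhammer_shift (a : C) (j : nat) :
  pochhammer a j * (a + INR j) = a * pochhammer (a + 1) j.
Proof.
induction j as [|j IH]; [simpl; ring|].
simpl pochhammer; rewrite IH, S_INR, RtoC_plus; ring.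
Qed.

Lemma pochhammer_pos_neq_0 (a : R) (j : nat) : (0 < a)%R -> pochhammer (RtoC a) j <> 0.
Proof.
intros Ha; induction j as [|j IH]; simpl.
- exact C1_nz.
- apply Cmult_neq_0; [exact IH|].
  rewrite <- RtoC_plus; intros E; apply RtoC_inj in E; assert (P := pos_INR j); lra.
Qed.

(* The parameter [m] stands for [2 b - 2], where [b] is the third upper parameter of 3F2. *)
Definition hyp_coef (m j : nat) : R :=
  (2 * (INR m + 2) * (half_coef (S j) / (2 * INR (S j) + INR m)))%R.

(** [(1)_j] cancels [j!], and [c = b + 1] makes [(b)_j / (c)_j] collapse to
    [b / (b + j) = (m + 2) / (2(j+1) + m)], the denominator of the arcsine-type series. *)
Lemma hyp3F2_term_eq (m j : nat) (b c z : C) :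
  b = RtoC (INR m / 2 + 1) -> c = RtoC (INR m / 2 + 2) ->
  hyp3F2_term 1 (3 / 2) b 2 c z j = RtoC (hyp_coef m j) * z ^ j.
Proof.
intros -> ->; unfold hyp3F2_term.
assert (Pm := pos_INR m); assert (Pj := pos_INR j).
rewrite pochhammer_one, pochhammer_three_halves.
assert (S := pochhammer_shift (RtoC (INR m / 2 + 1)) j).
rewrite <- !RtoC_plus in S.
replace (INR m / 2 + 1 + 1)%R with (INR m / 2 + 2)%R in S by ring.
assert (N2 := pochhammer_pos_neq_0 2 j ltac:(lra)).
assert (Nc := pochhammer_pos_neq_0 (INR m / 2 + 2) j ltac:(lra)).
assert (Na : RtoC (INR m / 2 + 1 + INR j) <> 0).
  intros E; apply RtoC_inj in E; lra.
assert (Nf : RtoC (INR (fact j)) <> 0).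
  intros E; apply RtoC_inj in E; now apply INR_fact_neq_0 in E.
set (pa := pochhammer (RtoC (INR m / 2 + 1)) j) in *.
set (pc := pochhammer (RtoC (INR m / 2 + 2)) j) in *.
assert (Epa : pa = RtoC (INR m / 2 + 1) * pc / RtoC (INR m / 2 + 1 + INR j)).
  rewrite <- S; field; exact Na.
rewrite Epa.
transitivity (RtoC (2 * half_coef (Datatypes.S j)) *
  (RtoC (INR m / 2 + 1) / RtoC (INR m / 2 + 1 + INR j)) * z ^ j).
  field; repeat split; assumption.
f_equal; rewrite <- RtoC_div, <- RtoC_mult by lra; f_equal.
unfold hyp_coef; rewrite S_INR; field; lra.
Qed.

Lemma hyp_coef_bound (m j : nat) :
  (1 <= m)%nat ->
  (0 <= hyp_coef m j <= 4 * (INR m + 2) * (half_coef (S j) / (2 * INR (S j) + 2)))%R.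
Proof.
intros Hm; unfold hyp_coef; assert (Pm := pos_INR m); assert (Pj := pos_INR (S j)).
assert (K := half_coef_pos (S j)).
assert (B := Cmod_arcsin_coef m 1 (S j) Hm ltac:(rewrite Cmod_1; lra)).
unfold arcsin_coef in B; rewrite Cpow_1_l, Cmult_1_r, Cmod_R in B.
assert (Q : (0 < half_coef (S j) / (2 * INR (S j) + INR m))%R).
  apply Rdiv_lt_0_compat; [lra|]; assert (P := pos_INR j); rewrite S_INR; lra.
rewrite Rabs_pos_eq in B by lra; split; nra.
Qed.

Lemma ex_series_hyp_coef (m : nat) : (1 <= m)%nat -> ex_series (hyp_coef m).
Proof.
intros Hm.
refine (ex_series_le (V := R_CompleteNormedModule) _ _ _
  (ex_series_scal_l (K := R_AbsRing) (V := R_NormedModule) (4 * (INR m + 2))%R _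
    (proj1 (ex_series_incr_1 _) ex_series_half_coef))).
intros j; destruct (hyp_coef_bound m j Hm) as [H1 H2].
change (norm (hyp_coef m j)) with (Rabs (hyp_coef m j)).
rewrite Rabs_pos_eq by exact H1; exact H2.
Qed.

Definition hyp_sum (m : nat) (z : C) : C :=
  C_pseries (fun j => RtoC (hyp_coef m j) * z ^ j) 1.

Lemma Cmod_hyp_term (m : nat) (z : C) (j : nat) :
  (1 <= m)%nat -> (Cmod z <= 1)%R -> (Cmod (RtoC (hyp_coef m j) * z ^ j) <= hyp_coef m j)%R.
Proof.
intros Hm Hz; rewrite Cmod_mult, Cmod_R.
assert (B := proj1 (hyp_coef_bound m j Hm)); rewrite Rabs_pos_eq by exact B.
assert (P := Cmod_pow_le_1 z j Hz); assert (N := Cmod_ge_0 (z ^ j)); nra.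
Qed.

Lemma is_series_C (a : nat -> C) (l : C) :
  is_series (fun n => Re (a n)) (Re l) -> is_series (fun n => Im (a n)) (Im l) ->
  is_series (V := C_NormedModule) a l.
Proof.
intros H1 H2; apply filterlim_locally; intros eps.
assert (K1 := proj1 (filterlim_locally _ _) H1 eps).
assert (K2 := proj1 (filterlim_locally _ _) H2 eps).
refine (filter_imp _ _ _ (filter_and _ _ K1 K2)); intros n [B1 B2].
assert (E : forall k, Re (sum_n a k) = sum_n (fun j => Re (a j)) k :> R /\
    Im (sum_n a k) = sum_n (fun j => Im (a j)) k :> R).
  intros k; induction k as [|k [I1 I2]].
  - rewrite !sum_O; split; reflexivity.
  - rewrite Csum_Sn, !sum_Sn, <- I1, <- I2; split; reflexivity.
destruct (E n) as [E1 E2]; split.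
- exact (eq_ind_r (fun r => ball (Re l) eps r) B1 E1).
- exact (eq_ind_r (fun r => ball (Im l) eps r) B2 E2).
Qed.

Lemma ex_series_dominated (r b : nat -> R) :
  (forall n, (Rabs (r n) <= b n)%R) -> ex_series b -> ex_series r.
Proof. intros H Hb; exact (ex_series_le (V := R_CompleteNormedModule) _ _ H Hb). Qed.

Lemma is_hyp3F2_hyp_sum (m : nat) (b c z : C) :
  (1 <= m)%nat -> (Cmod z <= 1)%R ->
  b = RtoC (INR m / 2 + 1) -> c = RtoC (INR m / 2 + 2) ->
  is_hyp3F2 1 (3 / 2) b 2 c z (hyp_sum m z).
Proof.
intros Hm Hz Hb Hc; unfold is_hyp3F2.
apply (is_series_ext (fun j => RtoC (hyp_coef m j) * z ^ j)).
  intros j; symmetry; now apply hyp3F2_term_eq.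
assert (Hs := ex_series_hyp_coef m Hm).
unfold hyp_sum, C_pseries; rewrite !PSeries_1.
apply is_series_C; apply Series_correct; apply (ex_series_dominated _ _) with (2 := Hs);
  intros j; apply Rle_trans with (2 := Cmod_hyp_term m z j Hm Hz);
  [apply re_le_Cmod|apply Rabs_Im_le_Cmod].
Qed.

(** Multiplication by [z] aligns the hypergeometric series with the tail [j >= 1] of the other one;
    [1 / m] is the missing term [j = 0]. *)
Lemma arcsin_primitive_hyp_sum (m : nat) (z : C) :
  (1 <= m)%nat -> (Cmod z <= 1)%R ->
  z * hyp_sum m z = 2 * (INR m + 2) * (arcsin_primitive m z 1 - 1 / INR m).
Proof.
intros Hm Hz; unfold arcsin_primitive; rewrite pow1, Cpow_1_l, Cmult_1_l.
assert (M : (1 <= INR m)%R) by (apply (le_INR 1); exact Hm).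
set (a := arcsin_coef m z).
assert (H := ex_series_arcsin_coef m z Hm Hz).
assert (E : C_pseries a 1 = 1 / INR m + C_pseries (fun j => a (S j)) 1).
  assert (A0 : a 0%nat = 1 / INR m).
    unfold a, arcsin_coef; simpl; rewrite Cmult_1_r, <- RtoC_div by lra.
    f_equal; field; lra.
  rewrite <- A0; unfold C_pseries; rewrite !PSeries_1; apply C_eq; simpl.
  - apply (Series_incr_1 (fun j => Re (a j))), (ex_series_dominated _ _) with (2 := H).
    intros j; apply re_le_Cmod.
  - apply (Series_incr_1 (fun j => Im (a j))), (ex_series_dominated _ _) with (2 := H).
    intros j; apply Rabs_Im_le_Cmod.
rewrite E.
assert (Hc := ex_series_hyp_coef m Hm).
assert (X : C_ex_pseries (fun j => RtoC (hyp_coef m j) * z ^ j) 1).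
  split; apply (ex_series_dominated _ _) with (2 := Hc); intros j; rewrite pow1, Rmult_1_r;
    apply Rle_trans with (2 := Cmod_hyp_term m z j Hm Hz);
    [apply re_le_Cmod|apply Rabs_Im_le_Cmod].
assert (H' : ex_series (fun j => Cmod (a (S j)))).
  exact (proj1 (ex_series_incr_1 _) H).
assert (Y : C_ex_pseries (fun j => a (S j)) 1).
  split; apply (ex_series_dominated _ _) with (2 := H'); intros j; rewrite pow1, Rmult_1_r;
    [apply re_le_Cmod|apply Rabs_Im_le_Cmod].
transitivity (2 * (INR m + 2) * C_pseries (fun j => a (S j)) 1); [|ring].
(* Zero multiples pad both sides to two-term combinations, the form handled by
   [C_pseries_linear]. *)
transitivity (C_pseries (fun j => z * (RtoC (hyp_coef m j) * z ^ j) + 0 * a (S j)) 1).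
  rewrite C_pseries_linear by assumption; unfold hyp_sum; ring.
transitivity (C_pseries (fun j => 0 * (RtoC (hyp_coef m j) * z ^ j) +
    2 * (INR m + 2) * a (S j)) 1).
2: rewrite C_pseries_linear by assumption; ring.
apply C_pseries_ext; intros j; unfold a, arcsin_coef, hyp_coef.
rewrite Cpow_S, !(RtoC_mult (2 * _)), (RtoC_mult 2), (RtoC_plus (INR m)); ring.
Qed.

(** Every term beyond the first carries a factor [z]. This linear estimate gives the continuity at 0
    that the removable singularity requires. *)
Lemma hyp_sum_near_0 (m : nat) (z : C) :
  (1 <= m)%nat -> (Cmod z <= 1)%R ->
  (Rabs (Re (hyp_sum m z) - hyp_coef m 0) <= Cmod z * Series (fun j => hyp_coef m (S j)))%R /\
  (Rabs (Im (hyp_sum m z)) <= Cmod z * Series (fun j => hyp_coef m (S j)))%R.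
Proof.
intros Hm Hz.
assert (Hc := ex_series_hyp_coef m Hm).
assert (G : forall r : nat -> R,
    (forall j, Rabs (r j) <= Cmod (RtoC (hyp_coef m j) * z ^ j))%R ->
    (Rabs (PSeries r 1 - r 0%nat) <= Cmod z * Series (fun j => hyp_coef m (S j)))%R).
  intros r Hr.
  assert (B : forall j, (Rabs (r (S j)) <= Cmod z * hyp_coef m (S j))%R).
    intros j; apply Rle_trans with (1 := Hr (S j)).
    rewrite Cpow_S.
    replace (RtoC (hyp_coef m (S j)) * (z * z ^ j)) with
      (z * (RtoC (hyp_coef m (S j)) * z ^ j)) by ring.
    rewrite Cmod_mult; apply Rmult_le_compat_l; [apply Cmod_ge_0|].
    rewrite Cmod_mult, Cmod_R.
    assert (P := proj1 (hyp_coef_bound m (S j) Hm)); rewrite Rabs_pos_eq by exact P.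
    assert (L := Cmod_pow_le_1 z j Hz); assert (N := Cmod_ge_0 (z ^ j)); nra.
  assert (Hc1 := ex_series_scal_l (K := R_AbsRing) (V := R_NormedModule) (Cmod z) _
    (proj1 (ex_series_incr_1 _) Hc)).
  rewrite PSeries_1, Series_incr_1.
  2: { apply ex_series_dominated with (2 := Hc).
    intros j; apply Rle_trans with (1 := Hr j); now apply Cmod_hyp_term. }
  replace (_ + _ - _)%R with (Series (fun j => r (S j))) by ring.
  rewrite <- Series_scal_l.
  apply Rle_trans with (Series (fun j => Rabs (r (S j)))).
  - apply Series_Rabs, ex_series_dominated with (2 := Hc1).
    intros j; rewrite Rabs_Rabsolu; apply B.
  - apply Series_le; [|exact Hc1]; intros j; split; [apply Rabs_pos|apply B].
split.
- assert (K := G (fun j => Re (RtoC (hyp_coef m j) * z ^ j)) (fun j => re_le_Cmod _)).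
  cbv beta in K; rewrite (Re_RtoC_mult _ (z ^ 0)) in K.
  simpl (Re (z ^ 0)) in K; rewrite Rmult_1_r in K; exact K.
- assert (K := G (fun j => Im (RtoC (hyp_coef m j) * z ^ j)) (fun j => Rabs_Im_le_Cmod _)).
  cbv beta in K; rewrite (Im_RtoC_mult _ (z ^ 0)) in K.
  simpl (Im (z ^ 0)) in K; rewrite Rmult_0_r, Rminus_0_r in K; exact K.
Qed.

Lemma is_value_ext0_hyp_sum (m : nat) (f : C -> C) (z : C) :
  (1 <= m)%nat -> (Cmod z <= 1)%R ->
  (forall w : C, w <> 0 -> (Cmod w <= 1)%R -> hyp_sum m w = f w) ->
  is_value_ext0 f z (hyp_sum m z).
Proof.
intros Hm Hz Hf; split; [intros N; now apply Hf|intros ->].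
apply filterlim_locally; intros eps.
set (M := Series (fun j => hyp_coef m (S j))).
(* At [z = 0] the bound is 0, so this determines the value [hyp_sum m 0] exactly. *)
destruct (hyp_sum_near_0 m 0 Hm Hz) as [Z1 Z2].
rewrite Cmod_0, Rmult_0_l in Z1, Z2.
(* A ball bounds the components, so [|w| < 2 d]. The first entry then keeps [|w| <= 1], where the
   closed form is known, and the second gives [|w| M < eps]. *)
set (d := Rmin (/ 2) (eps / (2 * (Rabs M + 1)))).
assert (PM := Rabs_pos M); assert (Pe := cond_pos eps).
assert (Hd : (0 < d)%R).
  apply Rmin_pos; [lra|apply Rdiv_lt_0_compat; lra].
exists (mkposreal d Hd); intros w [B1 B2] N.
change (Rabs (Re w - 0) < d)%R in B1; change (Rabs (Im w - 0) < d)%R in B2.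
rewrite Rminus_0_r in B1, B2.
assert (Hw : (Cmod w < 2 * d)%R).
  apply Rle_lt_trans with (1 := Cmod_2Rmax w).
  assert (X : (Rmax (Rabs (fst w)) (Rabs (snd w)) < d)%R) by (apply Rmax_lub_lt; assumption).
  assert (Q : (sqrt 2 < 2)%R).
    rewrite <- (sqrt_Rsqr 2) at 2 by lra; apply sqrt_lt_1; unfold Rsqr; lra.
  assert (X0 : (0 <= Rmax (Rabs (fst w)) (Rabs (snd w)))%R).
    apply Rle_trans with (2 := Rmax_l _ _); apply Rabs_pos.
  assert (S0 := sqrt_pos 2); nra.
assert (D1 : (d <= / 2)%R) by apply Rmin_l.
assert (D2 : (d <= eps / (2 * (Rabs M + 1)))%R) by apply Rmin_r.
assert (W1 : (Cmod w <= 1)%R) by lra.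
rewrite <- Hf by assumption.
destruct (hyp_sum_near_0 m w Hm W1) as [H1 H2]; fold M in H1, H2.
assert (L : (Cmod w * M < eps)%R).
  apply Rle_lt_trans with (Cmod w * Rabs M)%R.
    apply Rmult_le_compat_l; [apply Cmod_ge_0|apply Rle_abs].
  apply Rle_div_r in D2; [|lra].
  assert (N0 := proj1 (Cmod_gt_0 w) N); nra.
apply Rabs_le_between in Z1, Z2, H1, H2.
split.
- change (Rabs (Re (hyp_sum m w) - Re (hyp_sum m 0)) < eps)%R; apply Rabs_def1; lra.
- change (Rabs (Im (hyp_sum m w) - Im (hyp_sum m 0)) < eps)%R; apply Rabs_def1; lra.
Qed.

(** * Assembly of the closed forms *)

Lemma Csqrt_neq_0 (z : C) : z <> 0 -> Csqrt z <> 0.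
Proof. intros H E; apply H; rewrite <- (Csqrt_sqr z), E; ring. Qed.

Lemma C4_pow_neq_0 (n : nat) : (4 : C) ^ n <> 0.
Proof. apply Cpow_nz; intros E; apply RtoC_inj in E; lra. Qed.

Theorem corollary3 (n : nat) (z : C) (hz : (Cmod z <= 1)%R) :
  (exists v : C,
     is_hyp3F2 1 (3 / 2) (3 / 2 + INR n) 2 (5 / 2 + INR n) z v /\
     is_value_ext0
       (fun w : C =>
          (3 + 2 * INR n) / (1 + 2 * INR n) * (2 / w) *
          ((1 + 2 * INR n) / 4 ^ n * (1 / Cpower w (INR n + 1 / 2)) *
             (binom (2 * n) n * Carcsin (Csqrt w) +
              (-1) ^ n *
                sum_n (fun k : nat =>
                  if Nat.eq_dec k n then RtoC 0 else
                  (-1) ^ k * binom (2 * n) k *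
                  (Csin (2 * (INR n - INR k) * Carcsin (Csqrt w)) /
                   (2 * (INR n - INR k)))) (2 * n)%nat) - 1))
       z v) /\
  (exists v : C,
     is_hyp3F2 1 (3 / 2) (2 + INR n) 2 (3 + INR n) z v /\
     is_value_ext0
       (fun w : C =>
          2 * (2 + INR n) / w *
          ((-1) ^ (1 + n) / 4 ^ n * (1 / w ^ (1 + n)) *
             sum_n (fun k : nat =>
               (-1) ^ k * binom (1 + 2 * n) k *
               ((Ccos ((2 * INR n - 2 * INR k + 1) * Carcsin (Csqrt w)) - 1) /
                (2 * INR n - 2 * INR k + 1))) (1 + 2 * n)%nat
           - 1 / (1 + INR n)))
       z v).
Proof.
assert (P := pos_INR n).
split.
(* [3/2 + n = m/2 + 1] gives [m = 2n + 1]; in the second half, [2 + n = m/2 + 1] gives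
   [m = 2n + 2]. *)
- exists (hyp_sum (2 * n + 1) z); split.
  + apply is_hyp3F2_hyp_sum; [lia|exact hz| |];
      rewrite plus_INR, mult_INR; simpl INR;
      rewrite <- RtoC_div, <- RtoC_plus by lra; f_equal; field.
  + apply is_value_ext0_hyp_sum; [lia|exact hz|]; intros w Hw W1.
    rewrite Cpower_add_half by exact Hw.
    assert (E := arcsin_primitive_even n w (Csqrt w) (Csqrt_sqr w) W1).
    rewrite <- E.
    assert (H := arcsin_primitive_hyp_sum (2 * n + 1) w ltac:(lia) W1).
    set (p := arcsin_primitive _ w 1) in *.
    assert (Nx := Cpow_nz _ (2 * n + 1) (Csqrt_neq_0 w Hw)).
    assert (N4 := C4_pow_neq_0 n).
    assert (Nn : 1 + 2 * RtoC (INR n) <> 0).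
      rewrite <- RtoC_mult, <- RtoC_plus; intros F; apply RtoC_inj in F; lra.
    replace (hyp_sum (2 * n + 1) w) with (w * hyp_sum (2 * n + 1) w / w) by now field.
    rewrite H, plus_INR, mult_INR, RtoC_plus, RtoC_mult; simpl INR.
    rewrite RtoC_plus.
    field; repeat split; trivial.
- exists (hyp_sum (2 * n + 2) z); split.
  + apply is_hyp3F2_hyp_sum; [lia|exact hz| |];
      rewrite plus_INR, mult_INR; simpl INR;
      rewrite <- RtoC_plus; f_equal; field.
  + apply is_value_ext0_hyp_sum; [lia|exact hz|]; intros w Hw W1.
    assert (E := arcsin_primitive_odd n w (Csqrt w) (Csqrt_sqr w) W1).
    assert (H := arcsin_primitive_hyp_sum (2 * n + 2) w ltac:(lia) W1).
    set (p := arcsin_primitive _ w 1) in *.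
    set (S0 := sum_n _ _) in *.
    (* The exponent is even, so the square root disappears and an integer power of [w] remains. *)
    assert (E1 : Csqrt w ^ (2 * n + 2) = w ^ (1 + n)).
      replace (2 * n + 2)%nat with (2 * (1 + n))%nat by lia.
      rewrite Cpow_mult_r; f_equal; rewrite <- (Csqrt_sqr w) at 2; simpl; ring.
    rewrite E1 in E.
    assert (N4 := C4_pow_neq_0 n).
    assert (Nw := Cpow_nz _ (1 + n) Hw).
    assert (Nn : 1 + RtoC (INR n) <> 0).
      rewrite <- RtoC_plus; intros F; apply RtoC_inj in F; lra.
    assert (E2 : (-1) ^ (1 + n) / 4 ^ n * (1 / w ^ (1 + n)) * S0 = 2 * p).
      transitivity (2 * ((-1) ^ (1 + n) / 2 * S0) / (4 ^ n * w ^ (1 + n))).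
        field; split; assumption.
      rewrite <- E; field; split; assumption.
    rewrite E2.
    replace (hyp_sum (2 * n + 2) w) with (w * hyp_sum (2 * n + 2) w / w) by now field.
    rewrite H, plus_INR, mult_INR, RtoC_plus, RtoC_mult; simpl INR.
    rewrite RtoC_plus.
    field; repeat split; trivial.
    intros F; apply Nn.
    transitivity ((2 * INR n + 2) / 2); [field|].
    change (2 * RtoC (INR n) + 2 = 0) in F; rewrite F; field.
Qed.
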